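(* Let $G$ be a non-solvable generalized Baumslag-Solitar group, let $\Phi\in\mathrm{Out}(G)$, and let $g\in G$ be an element whose conjugacy class is pseudo-periodic for $\Phi$. Suppose $f:T\to T$ is a train track representative for $\Phi$. Then the axis of $g$ in $T$ is a concatenation of periodic indivisible Nielsen paths for $f$.
   Context: A generalized Baumslag-Solitar (GBS) group is the fundamental group of a finite graph of groups whose vertex and edge groups are all infinite cyclic. It is non-solvable if it is isomorphic to none of $\mathbb Z$, $\mathbb Z^2$, the Klein bottle group, $\mathrm{BS}(1,n)=\langle a,t\mid tat^{-1}=a^n\rangle$ ($n\in\mathbb Z\setminus\{0\}$). For such $G$, $\mathcal D$ is the set of minimal simplicial metric $G$-trees with infinite cyclic vertex and edge stabilizers, up to equivariant isometry and homothety. An element $g\in G$ is loxodromic if it fixes no point in some (equivalently every) $T\in\mathcal D$; $\|g\|_T$ denotes the translation length. The conjugacy class of a loxodromic $g$ is pseudo-periodic for $\Phi$ if for some $\phi\in\Phi$ and some (equivalently any) $T\in\mathcal D$, $(\|\phi^n(g)\|_T)_{n\in\mathbb N}$ is bounded (only loxodromic classes are called pseudo-periodic). Train tracks. Let $T\in\mathcal D$. A map $f:T\to T$ represents $\phi\in\mathrm{Aut}(G)$ if $f(gx)=\phi(g)f(x)$ for all $g\in G,x\in T$; maps send vertices to vertices and edges to non-backtracking edge paths. A turn is an unordered pair of distinct edges $\{e,e'\}$ with the same origin; it is illegal if for some $n\ge1$ the paths $f^n(e),f^n(e')$ have a common initial segment of positive length, and legal otherwise. A non-backtracking path is legal if all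 turns it crosses are legal. $f$ is a train track map if $f(e)$ is legal for every edge $e$. A train track representative of $\Phi$ is a train track map representing some $\phi\in\Phi$. The transition matrix $A(f)$ has as $(i,j)$ entry the number of edges in the orbit of $e_i$ in $f(e_j)$ (regardless of orientation), where $e_1,\dots,e_n$ represent the $G$-orbits of unoriented edges. Convention: $A(f)$ is irreducible, and the metric on $T$ is chosen so that $f$ stretches every edge uniformly by the same factor $\lambda$ (the Perron-Frobenius eigenvalue of $A(f)$), with $\lambda>1$. Nielsen paths. For a path $\alpha$ in $T$, $[\alpha]$ is the geodesic with the same endpoints. A periodic Nielsen path is a nondegenerate geodesic segment $\gamma\subset T$ (endpoints need not be vertices) such that for some $n\ge1$, $h\in G$, $f^n(\gamma)$ and $h\gamma$ have the same endpoints, respecting the order of endpoints (i.e. $h^{-1}f^n$ fixes both endpoints of $\gamma$). It is a periodic indivisible Nielsen path (pINP) if it is not a concatenation, without backtracking, of two shorter periodic Nielsen paths. *)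

(* Defs.v *)
From HB Require Import structures.
From mathcomp Require Import all_boot all_order all_algebra finmap.
From mathcomp Require Import all_classical all_reals all_analysis.

Set Implicit Arguments.
Unset Strict Implicit.
Unset Printing Implicit Defensive.

Import Order.TTheory GRing.Theory Num.Theory.
Local Open Scope classical_set_scope.
Local Open Scope ring_scope.

(** * Groups *)

Definition zpow (G : groupType) (x : G) (n : int) : G :=
  match n with
  | Posz k => (x ^+ k)%g
  | Negz k => (x ^- k.+1)%g
  end.

Definition infinite_cyclic (G : groupType) (S : set G) : Prop :=
  exists i : int -> G,
    [/\ injective i, forall m n, i (m + n) = (i m * i n)%g & range i = S].

Definition iso_Z (G : groupType) : Prop := infinite_cyclic [set: G].

Definition iso_Z2 (G : groupType) : Prop :=
  exists i : int * int -> G,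
    bijective i /\ forall m n, i (m + n) = (i m * i n)%g.

(* [G] is the group < a, t | rel a t >: the relation is given as a formula [rel]
   that makes sense in every group, and the presentation is understood through
   its universal property. *)
Definition presented2 (rel : forall H : groupType, H -> H -> Prop)
    (G : groupType) : Prop :=
  exists a t : G, rel G a t /\
    forall (H : groupType) (a' t' : H), rel H a' t' ->
      exists phi : {multiplicative G -> H},
        [/\ phi a = a', phi t = t' &
          forall psi : {multiplicative G -> H},
            psi a = a' -> psi t = t' -> psi =1 phi].

Definition iso_BS1 (n : int) : groupType -> Prop :=
  presented2 (fun H a t => (t * a * t^-1)%g = zpow a n).

Definition iso_Klein : groupType -> Prop :=
  presented2 (fun H a t => (t * a * t^-1)%g = (a^-1)%g).

Definition non_solvable (G : groupType) : Prop :=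
  [/\ ~ iso_Z G, ~ iso_Z2 G, ~ iso_Klein G &
      forall n : int, n != 0 -> ~ iso_BS1 n G].

(** * Finite graphs of groups *)

(* [gog_E] is the set of unoriented edges, each with a chosen orientation from
   [gog_src] to [gog_tgt]; loops and multiple edges are allowed. *)
Record graph_of_groups := GraphOfGroups {
  gog_V : finType;
  gog_E : finType;
  gog_src : gog_E -> gog_V;
  gog_tgt : gog_E -> gog_V;
  gog_vgrp : gog_V -> groupType;
  gog_egrp : gog_E -> groupType;
  gog_isrc : forall e, {multiplicative gog_egrp e -> gog_vgrp (gog_src e)};
  gog_itgt : forall e, {multiplicative gog_egrp e -> gog_vgrp (gog_tgt e)};
  gog_isrc_inj : forall e, injective (gog_isrc e);
  gog_itgt_inj : forall e, injective (gog_itgt e) }.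

Definition connects (Y : graph_of_groups) (S : {set gog_E Y}) : bool :=
  (0 < #|gog_V Y|)%N &&
  [forall u : gog_V Y, forall v : gog_V Y,
    connect [rel x y | [exists e in S,
      ((gog_src e == x) && (gog_tgt e == y)) ||
      ((gog_src e == y) && (gog_tgt e == x))]] u v].

(* A maximal subtree: a minimal set of edges connecting all the vertices. *)
Definition maximal_tree (Y : graph_of_groups) (S : {set gog_E Y}) : bool :=
  minset (@connects Y) S.

(* Families [j], [t] in [H] satisfying the defining relations of pi_1(Y, S). *)
Definition pi1_relations (Y : graph_of_groups) (S : {set gog_E Y})
    (H : groupType) (j : forall v : gog_V Y, {multiplicative gog_vgrp v -> H})
    (t : gog_E Y -> H) : Prop :=
  (forall e, e \in S -> t e = 1%g) /\
  (forall e (c : gog_egrp e),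
     (t e * j (gog_tgt e) (gog_itgt e c) * (t e)^-1)%g
     = j (gog_src e) (gog_isrc e c)).

Definition is_pi1 (Y : graph_of_groups) (S : {set gog_E Y})
    (G : groupType) : Prop :=
  exists (j : forall v : gog_V Y, {multiplicative gog_vgrp v -> G})
         (t : gog_E Y -> G),
    pi1_relations S j t /\
    forall (H : groupType)
           (j' : forall v : gog_V Y, {multiplicative gog_vgrp v -> H})
           (t' : gog_E Y -> H),
      pi1_relations S j' t' ->
      exists phi : {multiplicative G -> H},
        [/\ forall v x, phi (j v x) = j' v x,
            forall e, phi (t e) = t' e &
            forall psi : {multiplicative G -> H},
              (forall v x, psi (j v x) = j' v x) ->
              (forall e, psi (t e) = t' e) -> psi =1 phi].

Definition GBS (G : groupType) : Prop :=
  exists (Y : graph_of_groups) (S : {set gog_E Y}),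
    [/\ forall v : gog_V Y, infinite_cyclic [set: gog_vgrp v],
        forall e : gog_E Y, infinite_cyclic [set: gog_egrp e],
        maximal_tree S &
        is_pi1 S G].

(** * Automorphisms *)

Definition automorphism (G : groupType) (phi : G -> G) : Prop :=
  bijective phi /\ forall x y, phi (x * y)%g = (phi x * phi y)%g.

(* An element of Out(G), as a coset of Inn(G) in Aut(G). *)
Definition outer_automorphism (G : groupType) (Phi : set (G -> G)) : Prop :=
  exists phi, automorphism phi /\
    Phi = [set psi | exists c : G, forall x, psi x = (c * phi x * c^-1)%g].

(** * Simplicial metric trees *)

Definition segment (R : realType) (X : metricType R) (x y : X) : set X :=
  [set z | mdist x z + mdist z y = mdist x y].

(* (u, v) is an oriented edge for the vertex set V; the edge itself, as a
   subset of the tree, is [segment u v]. *)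
Definition edge_for (R : realType) (X : metricType R) (V : set X) (u v : X) :
    Prop :=
  u != v /\ segment u v `&` V = [set u; v].

(* A nonempty simplicial tree with edge lengths, seen as the metric space X:
   X is a geodesic 0-hyperbolic space (an R-tree), subdivided by V into edges
   that meet only at vertices. The last clause makes the graph with vertex set V
   connected. *)
Definition simplicial_metric_tree (R : realType) (X : metricType R)
    (V : set X) : Prop :=
  [/\ V !=set0 /\
      (forall (x y : X) (s : R), 0 <= s <= mdist x y ->
        exists2 z, segment x y z & mdist x z = s),
      (forall x y z w : X, mdist x y + mdist z w <=
        Num.max (mdist x z + mdist y w) (mdist x w + mdist y z)),
      (forall x : X, ~ V x -> exists u v, edge_for V u v /\ segment u v x),
      (forall u v u' v' x : X, edge_for V u v -> edge_for V u' v' ->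
        ~ V x -> segment u v x -> segment u' v' x ->
        [set u; v] = [set u'; v']) &
      (forall u v : X, V u -> V v -> finite_set (segment u v `&` V))].

(* Simplicial metric G-trees; as usual, G acts without inversions. *)
Record gtree (R : realType) (G : groupType) := GTree {
  gt_space :> metricType R;
  gt_vertex : set gt_space;
  gt_act : G -> gt_space -> gt_space;
  gt_tree : simplicial_metric_tree gt_vertex;
  gt_act1 : forall x, gt_act 1%g x = x;
  gt_actM : forall g h x, gt_act (g * h)%g x = gt_act g (gt_act h x);
  gt_act_isometry : forall g x y,
    mdist (gt_act g x) (gt_act g y) = mdist x y;
  gt_act_vertex : forall g x, gt_vertex x -> gt_vertex (gt_act g x);
  gt_act_noinv : forall g u v, edge_for gt_vertex u v ->
    ~ (gt_act g u = v /\ gt_act g v = u) }.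

Definition edge (R : realType) (G : groupType) (T : gtree R G) (u v : T) :
    Prop :=
  edge_for (@gt_vertex _ _ T) u v.

Definition minimal (R : realType) (G : groupType) (T : gtree R G) : Prop :=
  forall Y : set T, Y !=set0 ->
    (forall g x, Y x -> Y (gt_act g x)) ->
    (forall x y, Y x -> Y y -> segment x y `<=` Y) ->
    Y = setT.

Definition in_D (R : realType) (G : groupType) (T : gtree R G) : Prop :=
  [/\ minimal T,
      forall v : T, gt_vertex v -> infinite_cyclic [set g | gt_act g v = v] &
      forall u v : T, edge u v ->
        infinite_cyclic [set g | gt_act g u = u /\ gt_act g v = v]].

Definition translation_length (R : realType) (G : groupType) (T : gtree R G)
    (g : G) : R :=
  inf [set mdist x (gt_act g x) | x in [set: T]].

Definition axis (R : realType) (G : groupType) (T : gtree R G) (g : G) :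
    set T :=
  [set x | mdist x (gt_act g x) = translation_length T g].

Arguments axis {R G} T g.

Definition loxodromic (R : realType) (G : groupType) (g : G) : Prop :=
  exists2 T : gtree R G, in_D T & forall x : T, gt_act g x <> x.

Definition pseudo_periodic (R : realType) (G : groupType) (Phi : set (G -> G))
    (g : G) : Prop :=
  loxodromic R g /\
  exists phi, Phi phi /\
    exists2 T : gtree R G, in_D T &
      exists M : R, forall n, translation_length T (iter n phi g) <= M.

(** * Train tracks *)

(* The condition on [x], [y] says that the paths f^n(u, v) and f^n(u, v') agree
   on [0, eps]: it is the right one because maps stretch all edges by the same
   factor, so that both paths are parametrized with the same speed. *)
Definition illegal_turn (R : realType) (G : groupType) (T : gtree R G)
    (f : T -> T) (u v v' : T) : Prop :=
  exists n, (0 < n)%N /\ exists2 eps : R, 0 < eps &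
    forall x y : T, segment u v x -> segment u v' y ->
      mdist u x = mdist u y -> mdist u x <= eps -> iter n f x = iter n f y.

(* Legality of the geodesic edge path between two vertices [p], [q]. *)
Definition legal_path (R : realType) (G : groupType) (T : gtree R G)
    (f : T -> T) (p q : T) : Prop :=
  forall w a b : T, edge w a -> edge w b -> a <> b ->
    segment p q w -> segment p q a -> segment p q b -> ~ illegal_turn f w a b.

Definition represents (R : realType) (G : groupType) (T : gtree R G)
    (f : T -> T) (phi : G -> G) : Prop :=
  forall g x, f (gt_act g x) = gt_act (phi g) (f x).

(* Together with the preservation of vertices, this says that [f] maps each edge
   (u, v) linearly, with factor [lam], onto the geodesic edge path from [f u] to
   [f v]. The lengths of the edges then form a positive left eigenvector of the
   transition matrix, so that [lam] is its Perron-Frobenius eigenvalue. *)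
Definition stretches_edges (R : realType) (G : groupType) (T : gtree R G)
    (f : T -> T) (lam : R) : Prop :=
  forall u v x y : T, edge u v -> segment u v x -> segment u v y ->
    mdist (f x) (f y) = lam * mdist x y.

Definition same_edge_orbit (R : realType) (G : groupType) (T : gtree R G)
    (a b : T * T) : Prop :=
  exists h : G, b = (gt_act h a.1, gt_act h a.2) \/
                b = (gt_act h a.2, gt_act h a.1).

Definition edge_representatives (R : realType) (G : groupType) (T : gtree R G)
    (n : nat) (e : 'I_n -> T * T) : Prop :=
  (forall i, edge (e i).1 (e i).2) /\
  (forall u v : T, edge u v -> exists! i, same_edge_orbit (e i) (u, v)).

(* Edges crossed by the geodesic from [p] to [q], oriented from [p] to [q]. *)
Definition crossed_edges (R : realType) (G : groupType) (T : gtree R G)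
    (p q : T) : set (T * T) :=
  [set a | [/\ edge a.1 a.2, segment p q a.1, segment p q a.2 &
               mdist p a.1 < mdist p a.2]].

Definition transition_matrix (R : realType) (G : groupType) (T : gtree R G)
    (f : T -> T) (n : nat) (e : 'I_n -> T * T) : 'M[nat]_n :=
  \matrix_(i, j)
    #|` fset_set (crossed_edges (f (e j).1) (f (e j).2) `&`
                  [set a | same_edge_orbit (e i) a])|.

Definition irreducible_matrix (n : nat) (A : 'M[nat]_n) : Prop :=
  forall i j : 'I_n, exists k, (0 < k)%N /\ (0 < (A ^+ k) i j)%N.

Definition train_track_map (R : realType) (G : groupType) (T : gtree R G)
    (f : T -> T) : Prop :=
  [/\ forall v, gt_vertex v -> gt_vertex (f v),
      exists2 lam : R, 1 < lam & stretches_edges f lam,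
      exists n (e : 'I_n -> T * T), edge_representatives e /\
        irreducible_matrix (transition_matrix f e) &
      forall u v : T, edge u v -> legal_path f (f u) (f v)].

Definition train_track_representative (R : realType) (G : groupType)
    (T : gtree R G) (Phi : set (G -> G)) (f : T -> T) : Prop :=
  train_track_map f /\ exists2 phi, Phi phi & represents f phi.

(** * Nielsen paths *)

(* A geodesic segment is given by its ordered pair of endpoints. *)
Definition periodic_Nielsen (R : realType) (G : groupType) (T : gtree R G)
    (f : T -> T) (x y : T) : Prop :=
  x <> y /\ exists n (h : G),
    [/\ (0 < n)%N, iter n f x = gt_act h x & iter n f y = gt_act h y].

Definition pINP (R : realType) (G : groupType) (T : gtree R G)
    (f : T -> T) (x y : T) : Prop :=
  periodic_Nielsen f x y /\
  ~ (exists2 z, segment x y z & periodic_Nielsen f x z /\ periodic_Nielsen f z y).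

Definition concatenation_of_pINPs (R : realType) (G : groupType)
    (T : gtree R G) (f : T -> T) (L : set T) : Prop :=
  exists x : int -> T,
    [/\ forall i, pINP f (x i) (x (i + 1)),
        forall i j k : int, i <= j -> j <= k -> segment (x i) (x k) (x j) &
        L = \bigcup_i segment (x i) (x (i + 1))].

(* Main.v *)
Require Import Defs.
From HB Require Import structures.
From mathcomp Require Import all_boot all_order all_algebra.
From mathcomp Require Import all_classical all_reals all_analysis.
From mathcomp Require Import ring lra zify.

(** A conjugacy class is only pseudo-periodic because the cyclic vertex groups can
   absorb powers.  If [g] moves a vertex [x0] to [w], and [b] generates the
   stabilizer of [x0], then all elements with this property are [k b^j]; since
   [b] commensurates its conjugates, [k b^p k^-1 = b^q], so conjugation by powers
   of [b] changes [j] by multiples of [q - p], and if [p = q] then [b^p] commutes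
   with [k].  By local finiteness, a bounded orbit therefore satisfies
   [phi^m g = u (g s) u^-1] for some [m > 0] and an elliptic [s] commuting with
   [g].  Ellipticity does not depend on the tree in D: if an element
   commensurating all its conjugates were loxodromic, its axis would be
   [G]-invariant, the tree would be a line and [G] would be BS(1, 1) or
   BS(1, -1).

   In [T], such an [s] fixes the axis of [g] pointwise, so [F = u^-1 f^m] maps the
   axis to a path containing it.  Every edge of the axis is covered by the
   [F]-image of another one, and there are finitely many of them modulo [g], so
   some power of [F] maps an edge of the axis over a [g]-translate of itself; by
   expansion it has there a point [x] with [F^n x = g^c x].  The points of the
   axis with the same rotation number [c / n] form a nonempty [g]-invariant set,
   with at most one point in each edge because legal paths are expanded.
   Consecutive points of this set bound pINPs: a splitting point would be pinned
   by its distances to both endpoints, hence would belong to the set. *)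
Set Implicit Arguments.
Unset Strict Implicit.
Unset Printing Implicit Defensive.

Import Order.TTheory GRing.Theory Num.Theory.
Local Open Scope classical_set_scope.
Local Open Scope ring_scope.

(** * Integer powers and the groups BS(1, 1) and BS(1, -1) *)

Section Zpow.
Variable G : groupType.
Local Open Scope group_scope.
Implicit Types (x y a b t : G) (m n : int).

Lemma zpow0 x : zpow x 0%R = 1. Proof. by []. Qed.
Lemma zpow1 x : zpow x 1%R = x. Proof. by []. Qed.
Lemma zpowN1 x : zpow x (- 1)%R = x^-1. Proof. by []. Qed.

Lemma zpowS x n : zpow x (n + 1)%R = zpow x n * x.
Proof.
case: n => [k|k]; first by rewrite -PoszD /= addn1 expgSr.
have -> : (Negz k + 1 = - k%:Z)%R by rewrite NegzE; lia.
case: k => [|k]; first by rewrite oppr0 /= expg1 mulVg.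
by rewrite -NegzE /= [in RHS]expgS invgM mulgVK.
Qed.

Lemma zpowB1 x n : zpow x (n - 1)%R = zpow x n * x^-1.
Proof. by rewrite -[in RHS](subrK 1%R n) zpowS mulgK. Qed.

Lemma zpowD x m n : zpow x (m + n)%R = zpow x m * zpow x n.
Proof.
elim: n => [|n IH|n IH]; first by rewrite addr0 mulg1.
  by rewrite -addn1 PoszD addrA !zpowS IH mulgA.
have -> : (- n.+1%:Z = - n%:Z - 1)%R by lia.
by rewrite addrA !zpowB1 IH mulgA.
Qed.

Lemma zpowN x n : zpow x (- n)%R = (zpow x n)^-1.
Proof. by apply/esym/mulg1_eq; rewrite -zpowD addrN. Qed.

Lemma zpowM x m n : zpow x (m * n)%R = zpow (zpow x m) n.
Proof.
elim: n => [|n IH|n IH]; first by rewrite mulr0.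
  by rewrite -addn1 PoszD mulrDr mulr1 zpowS -IH zpowD.
have -> : (- n.+1%:Z = - n%:Z - 1)%R by lia.
by rewrite mulrBr mulr1 zpowB1 -IH -zpowN -zpowD.
Qed.

Lemma zpow_conj y x n : zpow (y * x * y^-1) n = y * zpow x n * y^-1.
Proof.
elim: n => [|n IH|n IH]; first by rewrite !zpow0 mulg1 mulgV.
  by rewrite -addn1 PoszD !zpowS IH !mulgA mulgVK.
have -> : (- n.+1%:Z = - n%:Z - 1)%R by lia.
by rewrite !zpowB1 IH !invgM invgK !mulgA mulgVK.
Qed.

Lemma zpow_comm x y n : x * y = y * x -> zpow x n * y = y * zpow x n.
Proof.
move=> h.
have e : y * x * y^-1 = x by rewrite -h mulgK.
by rewrite -{1}e zpow_conj mulgVK.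
Qed.

End Zpow.

Section Zpow2.
Variable G : groupType.
Local Open Scope group_scope.
Implicit Types (x y a b t : G) (m n : int).

Lemma zpow_morph_eq (H : groupType) (f : G -> H) x n :
  (forall u v, f (u * v) = f u * f v) -> f (zpow x n) = zpow (f x) n.
Proof.
move=> fM.
have f1 : f 1 = 1 by apply: (mulgI (f 1)); rewrite -fM !mulg1.
have fV u : f u^-1 = (f u)^-1.
  by apply/esym/mulg1_eq; rewrite -fM mulgV.
elim: n => [|n IH|n IH]; first by rewrite !zpow0.
  by rewrite -addn1 PoszD !zpowS fM IH.
have -> : (- n.+1%:Z = - n%:Z - 1)%R by lia.
by rewrite !zpowB1 fM IH fV.
Qed.

Lemma infinite_cyclicP (S : set G) : infinite_cyclic S -> exists b,
  [/\ S b, forall n, S (zpow b n), forall x, S x -> exists n, x = zpow b n &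
      forall n, zpow b n = 1 -> n = 0%R].
Proof.
case=> i [inj iD iS].
have i0 : i 0%R = 1 by apply: (mulgI (i 0%R)); rewrite -iD addr0 mulg1.
have iz n : i n = zpow (i 1%R) n.
  have iB m : i (m - 1)%R = i m * (i 1%R)^-1.
    by have := iD (m - 1)%R 1%R; rewrite subrK => ->; rewrite mulgK.
  elim: n => [|n IH|n IH]; first by rewrite i0.
    by rewrite -addn1 PoszD iD IH zpowS.
  have -> : (- n.+1%:Z = - n%:Z - 1)%R by lia.
  by rewrite iB IH zpowB1.
exists (i 1%R); split.
- by rewrite -iS; exists 1%R.
- by move=> n; rewrite -iS -iz; exists n.
- by move=> x; rewrite -iS => -[n _ <-]; exists n; rewrite iz.
- by move=> n; rewrite -iz -i0 => /inj.
Qed.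

End Zpow2.

Section Zpow3.
Variable G : groupType.
Local Open Scope group_scope.
Implicit Types (x y a b t : G) (m n : int).

(** Since [e] is 1 or -1, the relation alone gives the product rule for words [a^m t^n], in every
    group where it holds. The map to [H] can therefore be defined on normal forms, and the product
    rule makes it a morphism. *)
Lemma presented_BS1 (e : int) a t : e = 1%R \/ e = (- 1)%R ->
  t * a * t^-1 = zpow a e ->
  (forall x, exists m n, x = zpow a m * zpow t n) ->
  (forall m n, zpow a m * zpow t n = 1 -> m = 0%R /\ n = 0%R) ->
  iso_BS1 e G.
Proof.
move=> he rel ex uniq.
(* This is [e] to the power [n], which depends only on the parity of [n]. *)
pose sg (n : int) : int := (if (odd `|n|%N) then e else 1)%R.
have comm (H : groupType) (a' t' : H) : t' * a' * t'^-1 = zpow a' e ->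
    forall m n, zpow t' n * zpow a' m = zpow a' (sg n * m)%R * zpow t' n.
  move=> r m n.
  have s1 (k : int) : t' * zpow a' k = zpow a' (e * k)%R * t'.
    by rewrite zpowM -r zpow_conj mulgVK.
  have ee : (e * e = 1)%R by case: he => ->.
  have s2 (k : int) : t'^-1 * zpow a' k = zpow a' (e * k)%R * t'^-1.
    apply: (mulgI t'); rewrite mulVKg mulgA s1 mulrA ee mul1r mulgK //.
  have sgS (k : int) : sg (k + 1)%R = (e * sg k)%R.
    rewrite /sg; have -> : odd `|(k + 1)%R|%N = ~~ odd `|k|%N by lia.
    by case: odd => /=; rewrite ?mulr1.
  have sgB (k : int) : sg (k - 1)%R = (e * sg k)%R.
    rewrite /sg; have -> : odd `|(k - 1)%R|%N = ~~ odd `|k|%N by lia.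
    by case: odd => /=; rewrite ?mulr1.
  elim: n m => [|n IH|n IH] m; first by rewrite !zpow0 mul1g mulg1 /sg mul1r.
    rewrite -addn1 PoszD zpowS -mulgA s1 !mulgA IH mulrA -!mulgA.
    by rewrite [(sg _ * e)%R]mulrC -sgS.
  have -> : (- n.+1%:Z = - n%:Z - 1)%R by lia.
  rewrite zpowB1 -mulgA s2 !mulgA IH mulrA -!mulgA.
  by rewrite [(sg _ * e)%R]mulrC -sgB.
have prod (H : groupType) (a' t' : H) : t' * a' * t'^-1 = zpow a' e ->
    forall m n m' n', zpow a' m * zpow t' n * (zpow a' m' * zpow t' n') =
      zpow a' (m + sg n * m')%R * zpow t' (n + n')%R.
  move=> r m n m' n'.
  by rewrite !zpowD -!mulgA [zpow t' n * (_ * _)]mulgA (comm _ _ _ r) !mulgA.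
have inj m n m' n' : zpow a m * zpow t n = zpow a m' * zpow t n' ->
    m = m' /\ n = n'.
  move=> h.
  have := uniq (m - m')%R (n - n')%R; rewrite !zpowD !zpowN.
  have -> : zpow a m * (zpow a m')^-1 = (zpow a m')^-1 * zpow a m.
    by rewrite -zpowN -!zpowD addrC.
  rewrite -!mulgA [zpow a m * (_ * _)]mulgA h -!mulgA mulgV mulg1 mulVg.
  by case=> // u v; split; apply/eqP; rewrite -subr_eq0 ?u ?v.
have /choice[M hM] : forall x, exists p : int * int,
    x = zpow a p.1 * zpow t p.2.
  by move=> x; have [m [n ->]] := ex x; exists (m, n).
have Meq m n : M (zpow a m * zpow t n) = (m, n).
  have := hM (zpow a m * zpow t n); case: (M _) => m' n' /= /inj[-> ->] //.
exists a, t; split=> // H a' t' r.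
pose phi x := zpow a' (M x).1 * zpow t' (M x).2.
have phiM : {morph phi : x y / x * y}.
  move=> x y; rewrite {1}(hM x) {1}(hM y) (prod _ _ _ rel) /phi Meq /=.
  by rewrite (prod _ _ _ r).
pose phiI := isMultiplicative.Build G H phi phiM.
pose phiH : {multiplicative G -> H} := HB.pack phi phiI.
exists phiH; split.
- by have := Meq 1%R 0%R; rewrite /= expg1 mulg1 /phi => ->; rewrite /= mulg1.
- by have := Meq 0%R 1%R; rewrite /= expg1 mul1g /phi => ->; rewrite /= mul1g.
- move=> psi pa pt x /=; rewrite {1}(hM x) /phi.
  rewrite gmulfM !(zpow_morph_eq (f := psi)) ?pa ?pt //; exact: gmulfM.
Qed.

End Zpow3.

(** * Segments in R-trees *)

Local Notation d := (@mdist _ _).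

(** The maximum in the four-point condition is split into a disjunction, so that a case analysis
    followed by linear arithmetic settles most facts about segments. *)
Definition rtree (R : realType) (X : metricType R) : Prop :=
  (forall (x y : X) (s : R), 0 <= s <= d x y ->
     exists2 z, segment x y z & d x z = s) /\
  (forall x y z w : X, d x y + d z w <= d x z + d y w \/
                       d x y + d z w <= d x w + d y z).

Lemma seq_argmin (R : realType) (A : eqType) (f : A -> R) (s : seq A) (a : A) :
  a \in s -> exists2 w, w \in s & forall z, z \in s -> f w <= f z.
Proof.
elim: s a => // b s IH a _; case: s IH => [_|e s IH].
  by exists b; rewrite ?mem_head // => z; rewrite inE => /eqP->.
have [w ws wmin] := IH e (mem_head _ _).
have [h|h] := leP (f b) (f w).
  exists b; rewrite ?mem_head // => z; rewrite inE => /orP[/eqP->//|zs].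
  by apply: le_trans h _; exact: wmin.
exists w; first by rewrite inE ws orbT.
by move=> z; rewrite inE => /orP[/eqP->|]; [exact: ltW|exact: wmin].
Qed.

Section RTree.
Variables (R : realType) (X : metricType R).
Implicit Types x y z w a b c : X.

Lemma mdist_tri y x z : d x z <= d x y + d y z.
Proof. exact: metric_triangle. Qed.

Lemma segE x y z : segment x y z = (d x z + d z y = d x y).
Proof. by []. Qed.

Lemma segl x y : segment x y x.
Proof. by rewrite segE mdistxx add0r. Qed.

Lemma segr x y : segment x y y.
Proof. by rewrite segE mdistxx addr0. Qed.

Lemma seg_sym x y z : segment x y z -> segment y x z.
Proof. by rewrite !segE (metric_sym y x) (metric_sym y z) (metric_sym z x) addrC. Qed.

Lemma segxx x z : segment x x z -> z = x.
Proof.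
rewrite segE mdistxx => h; apply: mdist_positivity.
have := mdist_ge0 x z; have := mdist_ge0 z x; lra.
Qed.

Lemma seg_le x y z : segment x y z -> 0 <= d x z <= d x y.
Proof.
rewrite segE => h; have := mdist_ge0 x z; have := mdist_ge0 z y; lra.
Qed.

Lemma seg_trans x y a b :
  segment x y a -> segment a y b -> segment x y b /\ segment x b a.
Proof.
rewrite !segE => h1 h2.
have := mdist_tri a x b; have := mdist_tri b x y.
by split; lra.
Qed.

Lemma segtl x y z w : segment x y z -> segment x z w -> segment x y w.
Proof.
rewrite !segE => h1 h2.
have := mdist_tri w x y; have := mdist_tri z w y; lra.
Qed.

Lemma segtr x y z w : segment x y z -> segment z y w -> segment x y w.
Proof.
by move=> /seg_sym h1 /seg_sym h2; apply: seg_sym; exact: segtl h1 h2.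
Qed.

Hypothesis rt : rtree X.
Let geo := rt.1.
Let fp := rt.2.

Lemma seg_uniq x y z w :
  segment x y z -> segment x y w -> d x z = d x w -> z = w.
Proof.
rewrite !segE => h1 h2 h; apply: mdist_positivity.
have := mdist_ge0 z w; rewrite (metric_sym z y) in h1; rewrite (metric_sym w y) in h2.
by case: (fp x y z w); lra.
Qed.

Lemma seg_ord x y z w :
  segment x y z -> segment x y w -> d x z <= d x w -> segment x w z.
Proof.
rewrite !segE => h1 h2 h.
have := mdist_tri z x w.
have := metric_sym z y; have := metric_sym w y.
by case: (fp x y z w); lra.
Qed.

Lemma seg_dist x y z w : segment x y z -> segment x y w -> d x z <= d x w ->
  d z w = d x w - d x z.
Proof. by move=> h1 h2 h; have := seg_ord h1 h2 h; rewrite segE; lra. Qed.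

Lemma seg_distn x y z w : segment x y z -> segment x y w ->
  d z w = `|d x w - d x z|.
Proof.
move=> h1 h2; have [h|h] := leP (d x z) (d x w).
  by rewrite (seg_dist h1 h2 h) ger0_norm // subr_ge0.
rewrite metric_sym (seg_dist h2 h1 (ltW h)) distrC ger0_norm // subr_ge0.
exact: ltW.
Qed.

Lemma seg_convex x y a b z :
  segment x y a -> segment x y b -> segment a b z -> segment x y z.
Proof.
move=> ha hb hz; have [h|h] := leP (d x a) (d x b).
  have h1 := seg_ord ha hb h.
  by apply: (segtl hb); apply: (segtr h1).
have h1 := seg_ord hb ha (ltW h).
by apply: (segtl ha); apply: (segtr h1); apply: seg_sym.
Qed.

Lemma seg_union x y z w : segment x y z -> segment x w z \/ segment w y z.
Proof.
rewrite !segE => h1.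
have := mdist_tri z x w; have := mdist_tri z w y.
have := metric_sym z w; have := metric_sym z y; have := metric_sym w y.
by case: (fp x y z w) => h *; [right|left]; lra.
Qed.

(** Local geodesics are geodesics in an R-tree. The overlap of the two pieces has to be
    nondegenerate, since otherwise the path could backtrack at the common point. *)
Lemma seg_chain x y z w :
  segment x z y -> segment y w z -> y <> z -> d x w = d x y + d y z + d z w.
Proof.
rewrite !segE => h1 h2 /eqP; rewrite -mdist_gt0 => h.
have := mdist_tri y x w; have := mdist_tri z y w.
have := metric_sym z y.
by case: (fp x z y w); lra.
Qed.

Lemma tripod x y z : exists c,
  [/\ segment x y c, segment x z c, segment y z c &
      d x c = (d x y + d x z - d y z) / 2].
Proof.
(* The Gromov product of [y] and [z] at [x]: the length along which the geodesics from [x] agree. *)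
set s := (d x y + d x z - d y z) / 2.
have t1 := mdist_tri x y z; have t2 := mdist_tri y x z.
have t3 := mdist_tri z x y.
have s1 := metric_sym x y; have s2 := metric_sym y z; have s3 := metric_sym x z.
have [|c hc xc] := geo (x := x) (y := y) (s := s).
  by rewrite /s; lra.
exists c; rewrite !segE; move: hc; rewrite segE => hc.
have u1 := mdist_tri c x z; have u2 := mdist_tri c y z.
have u3 := metric_sym c x; have u4 := metric_sym c y; have u5 := metric_sym c z.
rewrite /s in xc.
by case: (fp x y c z) => h; split=> //; lra.
Qed.

Lemma midpoint x y : exists2 m, segment x y m & d x m = d x y / 2.
Proof. by apply: geo; have := mdist_ge0 x y; lra. Qed.

End RTree.

Lemma simplicial_rtree (R : realType) (X : metricType R) (V : set X) :
  simplicial_metric_tree V -> rtree X.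
Proof.
case=> -[_ h1] h2 _ _ _; split=> // x y z w.
have := h2 x y z w; rewrite le_max => /orP[h|h]; [by left|right].
by rewrite (metric_sym y z) in h * .
Qed.

(** * Isometrically embedded lines *)

Section Line.
Variables (R : realType) (X : metricType R).
Hypothesis rt : rtree X.

Definition isoline (c : R -> X) := forall s t, d (c s) (c t) = `|s - t|.

Lemma isoline_seg c s t z : isoline c -> s <= t -> segment (c s) (c t) z ->
  exists2 r, s <= r <= t & z = c r.
Proof.
move=> hc st hz; exists (s + d (c s) z).
  by have := seg_le hz; rewrite hc distrC ger0_norm; lra.
have /andP[h0 h1] := seg_le hz; rewrite hc distrC ger0_norm in h1; last lra.
apply: (seg_uniq rt hz); last by rewrite hc distrC ger0_norm; lra.
rewrite segE !hc distrC [in X in _ + X]distrC [in RHS]distrC !ger0_norm; lra.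
Qed.

Lemma isoline_mem c s t r : isoline c -> s <= r <= t -> segment (c s) (c t) (c r).
Proof.
move=> hc h; rewrite segE !hc distrC [in X in _ + X]distrC [in RHS]distrC.
rewrite !ger0_norm; lra.
Qed.

Lemma isoline_inj c s t : isoline c -> c s = c t -> s = t.
Proof.
move=> hc h; have := hc s t; rewrite h mdistxx => /esym/eqP.
by rewrite normr_eq0 subr_eq0 => /eqP.
Qed.

(** The nearest point on the line is the centre of the tripod spanned by [x] and two remote points
    of the line. *)
Lemma isoline_proj c x : isoline c ->
  exists t, forall s, d x (c s) = d x (c t) + `|s - t|.
Proof.
move=> hc; set N := d x (c 0) + 1.
have N1 : 1 <= N by rewrite /N; have := mdist_ge0 x (c 0); lra.
have [y [h1 h2 h3 hy]] := tripod rt (c (- N)) (c N) x.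
have [|t ht ety] := isoline_seg hc _ h1; first lra.
subst y.
have e1 (u v : R) : u <= v -> `|u - v| = v - u.
  by move=> uv; rewrite distrC ger0_norm // subr_ge0.
have := metric_sym x (c 0); have := metric_sym x (c N).
have := metric_sym x (c (- N)) => q1 q2 q3.
have n0 := e1 (-N) N; have n1 := e1 (-N) 0; have n2 := e1 0 N.
have tN : - N < t < N.
  have a1 := mdist_tri x (c (- N)) (c 0).
  have a2 := mdist_tri x (c 0) (c N).
  have a3 := mdist_tri (c 0) (x) (c N).
  have a4 := mdist_tri (c 0) (c (-N)) (x).
  move: hy; rewrite !hc (e1 (-N) t) ?(e1 (-N) N) //; try lra.
  rewrite !hc in a1 a2 a3 a4.
  rewrite /N in a1 a2 a3 a4 n0 n1 n2 *; lra.
exists t => s.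
have hL : d x (c t) + `|t + N| = d x (c (- N)).
  move: h2 => /seg_sym; rewrite segE hc => <-.
  by congr (_ + _); congr (`| _ |); lra.
have hR : d x (c t) + `|N - t| = d x (c N).
  by move: h3 => /seg_sym; rewrite segE hc => <-; rewrite [in RHS]distrC.
have sR : segment x (c N) (c t) by apply: seg_sym.
have sL : segment x (c (- N)) (c t) by apply: seg_sym.
have cD := seg_chain rt.
have [st|ts] := leP t s.
- have [sN|Ns] := leP s N.
    have := seg_trans sR (isoline_mem hc (s := t) (t := N) (r := s) _).
    case; first by lra.
    by move=> _; rewrite segE hc => <-; rewrite (e1 t s) // ger0_norm; lra.
  rewrite (cD x (c t) (c N) (c s)) ?hc; last first.
  + by move=> /(isoline_inj hc); lra.
  + by apply: isoline_mem => //; lra.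
  + by [].
  rewrite (e1 t N) ?(e1 N s) ?ger0_norm; lra.
- have [sN|Ns] := leP (- N) s.
    have := seg_trans sL (seg_sym (isoline_mem hc (s := -N) (t := t) (r := s) _)).
    case; first by lra.
    by move=> _; rewrite segE hc => <-; rewrite (e1 s t) ?ger0_norm; lra.
  rewrite (cD x (c t) (c (- N)) (c s)) ?hc; last first.
  + by move=> /(isoline_inj hc); lra.
  + by apply: seg_sym; apply: isoline_mem => //; lra.
  + by [].
  by rewrite (e1 s t) ?(ger0_norm (x := t - - N)) ?(ger0_norm (x := - N - s)); lra.
Qed.

Lemma isoline_of_seq (a : int -> X) (l : R) : 0 < l ->
  (forall i j, i <= j -> d (a i) (a j) = (j - i)%:~R * l) ->
  exists2 c, isoline c & forall i, c (i%:~R * l) = a i.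
Proof.
move=> l0 ha.
have fl t : (Num.floor (t / l))%:~R * l <= t < (Num.floor (t / l) + 1)%:~R * l.
  have /andP[h1 h2] := floor_itv (t / l).
  by rewrite -ler_pdivlMr // h1 -ltr_pdivrMr // h2.
have ha1 i : d (a i) (a (i + 1)) = l.
  by rewrite ha ?lerDl // addrC addKr mul1r.
have /choice[c hc] : forall t, exists z,
    segment (a (Num.floor (t / l))) (a (Num.floor (t / l) + 1)) z /\
    d (a (Num.floor (t / l))) z = t - (Num.floor (t / l))%:~R * l.
  move=> t; have [|z hz1 hz2] := rt.1 (a (Num.floor (t / l)))
    (a (Num.floor (t / l) + 1)) (t - (Num.floor (t / l))%:~R * l); last by exists z.
  by rewrite ha1; have := fl t; rewrite intrD mulrDl mul1r; lra.
have iso : forall s t, s <= t -> d (c s) (c t) = t - s.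
  move=> s t st; have [zs ds] := hc s; have [zt dt] := hc t.
  have fs := fl s; have ft := fl t.
  have ij : Num.floor (s / l) <= Num.floor (t / l).
    by rewrite -ltzD1 -(ltr_int R) -(ltr_pM2r l0); lra.
  move: (Num.floor (s / l)) (Num.floor (t / l)) ij zs ds zt dt fs ft => i j ij.
  move=> zs ds zt dt fs ft.
  have h1 : segment (a i) (a (j + 1)) (a (i + 1)).
    rewrite segE !ha; try lia.
    by rewrite -mulrDl -intrD; congr (_%:~R * _); lia.
  have h2 : segment (a i) (a (j + 1)) (a j).
    rewrite segE !ha; try lia.
    by rewrite -mulrDl -intrD; congr (_%:~R * _); lia.
  have g1 := segtl h1 zs.
  have [g2] := seg_trans h2 zt; rewrite segE dt ha // intrB => e2.
  rewrite (seg_dist rt g1 g2) ds; lra.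
exists c.
  move=> s t; have [st|ts] := leP s t.
    by rewrite iso // distrC ger0_norm // subr_ge0.
  by rewrite metric_sym iso ?(ltW ts) // ger0_norm // subr_ge0 ltW.
move=> i; have [] := hc (i%:~R * l).
have -> : Num.floor (i%:~R * l / l) = i.
  by apply: floor_def; rewrite mulfK ?gt_eqF // lexx ltr_int ltzD1 lexx.
rewrite subrr => _ h.
by apply/esym; apply: mdist_positivity.
Qed.

End Line.

(** * Simplicial G-trees *)

Local Notation act := (@gt_act _ _ _).
Local Notation vtx := (@gt_vertex _ _ _).

Section GTreeBasics.
Variables (R : realType) (G : groupType) (T : gtree R G).
Implicit Types (x y z u v w : T) (g h s : G).

Lemma gt_rtree : rtree T.
Proof. exact: simplicial_rtree (gt_tree T). Qed.
Let rt := gt_rtree.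

Lemma actK g x : act g^-1%g (act g x) = x.
Proof. by rewrite -gt_actM mulVg gt_act1. Qed.

Lemma actVK g x : act g (act g^-1%g x) = x.
Proof. by rewrite -gt_actM mulgV gt_act1. Qed.

Lemma act_inj g x y : act g x = act g y -> x = y.
Proof. by move=> h; rewrite -(actK g x) h actK. Qed.

Lemma act_seg g x y z : segment (act g x) (act g y) (act g z) <-> segment x y z.
Proof. by rewrite !segE !gt_act_isometry. Qed.

Lemma act_vtx g x : vtx (act g x) <-> vtx x.
Proof.
split; last exact: gt_act_vertex.
by move=> h; rewrite -(actK g x); exact: gt_act_vertex.
Qed.

Lemma edge_vtx u v : edge u v -> vtx u /\ vtx v.
Proof.
case=> _ h; have : [set u; v] `<=` vtx by rewrite -h => z [].
by move=> s; split; apply: s; [left|right].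
Qed.

Lemma edge_sym u v : edge u v -> edge v u.
Proof.
case=> uv h; split; first by rewrite eq_sym.
rewrite setUC -h; congr (_ `&` _).
by apply/seteqP; split=> z; exact: seg_sym.
Qed.

Lemma edge_neq u v : edge u v -> u <> v.
Proof. by case=> /eqP. Qed.

Lemma edge_gt0 u v : edge u v -> 0 < d u v.
Proof. by case=> ? _; rewrite mdist_gt0. Qed.

Lemma edge_seg_vtx u v z : edge u v -> segment u v z -> vtx z -> z = u \/ z = v.
Proof. by case=> _ h hz vz; have : (segment u v `&` vtx) z by []; rewrite h. Qed.

Lemma edgeI u v : vtx u -> vtx v -> u <> v ->
  (forall z, segment u v z -> vtx z -> z = u \/ z = v) -> edge u v.
Proof.
move=> vu vv uv h; split; first exact/eqP.
apply/seteqP; split=> z; first by case; exact: h.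
by case=> ->; split=> //; [exact: segl|exact: segr].
Qed.

Lemma act_edge g u v : edge u v -> edge (act g u) (act g v).
Proof.
move=> e; have [vu vv] := edge_vtx e.
apply: edgeI; rewrite ?act_vtx //; first by move=> /act_inj; exact: edge_neq.
move=> z; rewrite -(actVK g z) => /act_seg hz /act_vtx vz.
by have [->|->] := edge_seg_vtx e hz vz; [left|right].
Qed.

Lemma act_fixV g x : act g x = x -> act g^-1%g x = x.
Proof. by move=> h; rewrite -{1}h actK. Qed.

Lemma act_fix_zpow g x n : act g x = x -> act (zpow g n) x = x.
Proof.
move=> h; elim: n => [|n IH|n IH]; first by rewrite zpow0 gt_act1.
  by rewrite -addn1 PoszD zpowS gt_actM h IH.
have -> : (- n.+1%:Z = - n%:Z - 1)%R by lia.
by rewrite zpowB1 gt_actM act_fixV.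
Qed.

(** Only finitely many vertices lie on the segment; the edge ends at the one nearest to [u] among
    those other than [u]. *)
Lemma vtx_step u v : vtx u -> vtx v -> u <> v ->
  exists2 w, edge u w & segment u v w.
Proof.
move=> vu vv uv.
have [_ _ _ _ /(_ u v vu vv) fin] := gt_tree T.
have [s hs] := (finite_seqP _).1 fin.
have vs : v \in [seq z <- s | z != u].
  rewrite mem_filter; apply/andP; split; first by apply/eqP => e; apply: uv.
  by have : [set` s] v by rewrite -hs; split=> //; exact: segr.
set s' := [seq z <- s | z != u] in vs.
have [w ws wmin] := seq_argmin (d u) vs.
move: ws; rewrite mem_filter => /andP[/eqP wu ws].
have [sw vw] : (segment u v `&` vtx) w by rewrite hs.
exists w => //; apply: edgeI => //; first by move=> e; apply: wu.
move=> z hz vz; have [->|/eqP zu] := eqVneq z u; [by left|right].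
have zs' : z \in s'.
  rewrite mem_filter; apply/andP; split; first exact/eqP.
  have : (segment u v `&` vtx) z by split=> //; exact: segtl sw hz.
  by rewrite hs.
have := wmin z zs'; have /andP[_ h] := seg_le hz => h'.
apply: (seg_uniq rt hz); first exact: segr.
by apply/eqP; rewrite eq_le h h'.
Qed.

(** Induction along the edges of a segment; the extra hypotheses of the step record that the walk
    goes straight from [u] to [v]. *)
Lemma vtx_ind_seg (P : T -> Prop) u v : vtx u -> vtx v -> P u ->
  (forall a b, P a -> edge a b -> segment u v a -> segment u v b ->
     segment a v b -> P b) ->
  P v.
Proof.
move=> vu vv Pu step.
have [_ _ _ _ /(_ u v vu vv) fin] := gt_tree T.
have [s hs] := (finite_seqP _).1 fin.
(* The measure counts the vertices still ahead, those of the segment strictly closer to [v] than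
   [w]. *)
pose m (w : T) := size [seq z <- s | d v z < d v w].
suff H : forall n w, (m w < n)%N -> vtx w -> segment u v w -> P w -> P v.
  by apply: (H (m u).+1 u) => //; exact: segl.
elim=> // n IH w mw vw sw Pw.
have [->//|/eqP wv] := eqVneq v w.
have [|b eb sb] := vtx_step vw vv; first by move=> e; apply: wv.
have sb' : segment u v b by exact: segtr sw sb.
have [_ vb] := edge_vtx eb.
suff mb : (m b < m w)%N.
  by apply: (IH b) => //; [lia|exact: step Pw eb sw sb' sb].
rewrite /m !size_filter.
have lt : d v b < d v w.
  have := edge_gt0 eb; move: sb; rewrite segE (metric_sym v b) (metric_sym v w).
  lra.
have sbb : b \in s by have : [set` s] b by rewrite -hs.
have : (count (fun z => (d v z < d v b)%R) s + count (fun z => z == b) s <= count (fun z => (d v z < d v w)%R) s)%N.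
  elim: s {hs sbb mw IH} @m => //= z s' IH.
  have : ((d v z < d v b)%R + (z == b) <= (d v z < d v w)%R)%N.
    have [->|_] := eqVneq z b; first by rewrite ltxx lt.
    by case: ltP => // h; rewrite (lt_trans h lt).
  by move: IH; lia.
have : (0 < count (fun z => z == b) s)%N by rewrite -has_count has_pred1.
by lia.
Qed.

Lemma vtx_ind (P : T -> Prop) u v : vtx u -> vtx v -> P u ->
  (forall a b, P a -> edge a b -> P b) -> P v.
Proof.
move=> vu vv Pu h; apply: (vtx_ind_seg vu vv Pu) => a b Pa e _ _ _.
exact: h Pa e.
Qed.

Lemma vtx_ex : exists v : T, vtx v.
Proof. by have [[[v vv] _] _ _ _ _] := gt_tree T; exists v. Qed.

Lemma nonvtx_edge x : ~ vtx x -> exists u v, edge u v /\ segment u v x.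
Proof. by have [_ _ h _ _] := gt_tree T; exact: h. Qed.

Lemma edge_interior u v u' v' x : edge u v -> edge u' v' -> ~ vtx x ->
  segment u v x -> segment u' v' x -> (u' = u /\ v' = v) \/ (u' = v /\ v' = u).
Proof.
move=> e e' nx h h'.
have [_ _ _ /(_ _ _ _ _ _ e e' nx h h') E _] := gt_tree T.
have : [set u; v] u' by rewrite E; left.
have : [set u; v] v' by rewrite E; right.
have n1 := edge_neq e; have n2 := edge_neq e'.
by move=> [] /= ev [] /= eu; rewrite eu ev in n2 *; [|right|left|].
Qed.

End GTreeBasics.

(** * Axes of loxodromic elements *)

Section Axis.
Variables (R : realType) (G : groupType) (T : gtree R G).
Implicit Types (x y z u v w p q : T) (g h s : G) (l : R) (c : R -> T).
Let rt := gt_rtree T.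

(** Let [x], [y], [z] be consecutive points of an orbit. Removing from [[x, y]] the part that
    backtracks at [y], and its counterpart at [x], leaves a segment whose translates line up. *)
Lemma hyperbolic_point g : (forall x, act g x <> x) ->
  exists p, segment p (act g (act g p)) (act g p).
Proof.
move=> nofix; have [x _] := vtx_ex T.
set y := act g x; set z := act g y.
have xy : d y z = d x y by rewrite /z /y gt_act_isometry.
have [q [q1 q2 q3 ho]] := tripod rt y x z.
rewrite xy (metric_sym y x) in ho.
have [m hm dm] := midpoint rt x y.
have hgm : segment y z (act g m) by rewrite /z /y act_seg.
have dgm : d y (act g m) = d x y / 2 by rewrite gt_act_isometry.
have dm' : d y m = d x y / 2.
  by move: hm; rewrite segE dm (metric_sym m y); lra.
have ko : d y q < d x y / 2.
  rewrite ltNge; apply/negP => le; apply: (nofix m).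
  apply: (seg_uniq rt (x := y) (y := q)); last by rewrite dm'.
    by apply: (seg_ord rt hgm) => //; rewrite dgm.
  by apply: (seg_ord rt (seg_sym hm)) => //; rewrite dm'.
have k0 := mdist_ge0 y q.
have [|p hp dp] := rt.1 x y (d y q); first by lra.
have gpo : act g p = q.
  apply: (seg_uniq rt (x := y) (y := z)) => //; first by rewrite act_seg.
  by rewrite gt_act_isometry.
have so := seg_sym q1.
have xo : d x q = d x y - d y q.
  by move: so; rewrite segE (metric_sym q y); lra.
have px : segment x q p by apply: (seg_ord rt hp) => //; rewrite dp xo; lra.
have [_ pz] := seg_trans (seg_sym q3) (seg_sym px).
have go : segment y z (act g q) by rewrite /y /z act_seg.
have og : segment q z (act g q).
  have h : segment y (act g q) q.
    by apply: (seg_ord rt q2) => //; rewrite gt_act_isometry xo; lra.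
  by have [_ /seg_sym] := seg_trans (seg_sym go) (seg_sym h).
by exists p; rewrite gpo; have [_] := seg_trans (seg_sym pz) og.
Qed.

Definition is_axis g l c :=
  [/\ 0 < l, isoline c & forall t, act g (c t) = c (t + l)].

(** Three consecutive points of the orbit of [p] are aligned, so [seg_chain] makes the whole orbit
    geodesic; the axis interpolates it. *)
Lemma is_axis_ex g : (forall x, act g x <> x) -> exists l c, is_axis g l c.
Proof.
move=> nofix; have [p hp] := hyperbolic_point nofix.
pose a (i : int) := act (zpow g i) p; pose l := d p (act g p).
have l0 : 0 < l by rewrite mdist_gt0; apply/eqP => /esym/nofix.
have aS i : a (i + 1) = act g (a i).
  by rewrite /a zpowS -gt_actM; congr (gt_act _ _); exact: zpow_comm.
have a1 i : d (a i) (a (i + 1)) = l.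
  by rewrite /a zpowS gt_actM gt_act_isometry.
have sa i : segment (a i) (a (i + 1 + 1)) (a (i + 1)).
  by rewrite /a !zpowS -mulgA !gt_actM act_seg.
have an i (n : nat) : d (a i) (a (i + n%:Z)) = n%:R * l.
  (* Two consecutive values are carried along because [seg_chain] glues along the last step. *)
  suff: d (a i) (a (i + n%:Z)) = n%:R * l /\
        d (a i) (a (i + n.+1%:Z)) = n.+1%:R * l by case.
  elim: n => [|n [IH1 IH2]].
    by rewrite addr0 mdistxx mul0r a1 mul1r.
  split=> //.
  have e1 : i + n.+1%:Z = i + n%:Z + 1 by lia.
  have e2 : i + n.+2%:Z = i + n%:Z + 1 + 1 by lia.
  rewrite e2 (seg_chain rt (y := a (i + n%:Z)) (z := a (i + n%:Z + 1))) //.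
  + by rewrite IH1 !a1 -[n.+2]addn2 natrD; lra.
  + by rewrite segE IH1 a1 -e1 IH2 -natr1; lra.
  + by move=> e; have := a1 (i + n%:Z); rewrite -e mdistxx; lra.
have aD i j : i <= j -> d (a i) (a j) = (j - i)%:~R * l.
  move=> ij; have -> : j = i + `|(j - i)%R|%N%:Z by lia.
  by rewrite an pmulrn; congr (_%:~R * _); lia.
have [c hc ca] := isoline_of_seq rt l0 aD.
exists l, c; split=> // t.
set i := Num.floor (t / l).
have fl : i%:~R * l <= t < (i + 1)%:~R * l.
  have /andP[h1 h2] := floor_itv (t / l).
  by rewrite -ler_pdivlMr // h1 -ltr_pdivrMr // h2.
move: fl; rewrite intrD mulrDl mul1r => fl.
have m1 : segment (a i) (a (i + 1)) (c t).
  by rewrite -!ca; apply: isoline_mem => //; rewrite intrD mulrDl; lra.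
have m2 : segment (a (i + 1)) (a (i + 1 + 1)) (c (t + l)).
  by rewrite -!ca; apply: isoline_mem => //; rewrite !intrD !mulrDl; lra.
apply: (seg_uniq rt _ m2); first by rewrite aS (aS (i + 1)) act_seg.
rewrite {1}aS gt_act_isometry -!ca !hc; congr (`| _ |).
by rewrite !intrD !mulrDl; lra.
Qed.

(** The geodesic from [x] to its image goes down to the line, along it, and up again. The shift [k]
    may be negative, as happens for negative powers of an element with axis [c]. *)
Lemma disp_line h c (k : R) : isoline c -> k != 0 ->
  (forall t, act h (c t) = c (t + k)) -> forall x, exists t,
  (forall r : R, d x (c r) = d x (c t) + `|r - t|) /\
  d x (act h x) = 2 * d x (c t) + `|k|.
Proof.
move=> hc k0 hk x; have [t ht] := isoline_proj rt x hc.
exists t; split=> //.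
have k1 : 0 < `|k| by rewrite normr_gt0.
have ek (r : R) : `|r - (r + k)| = `|k| by rewrite opprD addrA subrr sub0r normrN.
have ek' : `|t + k - t| = `|k| by congr (`| _ |); lra.
have e (r : R) : d (act h x) (c r) = d x (c (r - k)).
  by rewrite -(gt_act_isometry h x) hk subrK.
rewrite (seg_chain rt (y := c t) (z := c (t + k))).
- by rewrite hc ek (metric_sym _ (act h x)) e addrK; lra.
- by rewrite segE hc ek [RHS]ht ek'.
- apply: seg_sym; rewrite segE !e addrK hc ek' [RHS]ht.
  by rewrite -[X in _ + X = _]normrN; congr (_ + `| _ |); lra.
- by move/(isoline_inj hc) => e0; move: k1; rewrite -(ek t) -e0 subrr normr0 ltxx.
Qed.

Lemma axis_disp g l c : is_axis g l c -> forall x, exists t,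
  (forall r : R, d x (c r) = d x (c t) + `|r - t|) /\
  d x (act g x) = 2 * d x (c t) + l.
Proof.
move=> [l0 hc hg] x; have [|t []] := disp_line hc _ hg x; first by rewrite gt_eqF.
by rewrite gtr0_norm //; exists t.
Qed.

Lemma axis_dist g l c t : is_axis g l c -> d (c t) (act g (c t)) = l.
Proof.
by case=> l0 hc ->; rewrite hc opprD addrA subrr sub0r normrN gtr0_norm.
Qed.

Lemma axis_tl g l c : is_axis g l c -> translation_length T g = l.
Proof.
move=> ax; have [l0 hc hg] := ax.
have lb x : l <= d x (act g x).
  by have [t [_ ->]] := axis_disp ax x; have := mdist_ge0 x (c t); lra.
apply/eqP; rewrite eq_le; apply/andP; split.
  apply: ge_inf; first by exists l => _ [x _ <-].
  by exists (c 0) => //; exact: axis_dist ax.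
by apply: lb_le_inf; [exists (d (c 0) (act g (c 0))); exists (c 0)|move=> _ [x _ <-]].
Qed.

Lemma axis_mem g l c x : is_axis g l c -> d x (act g x) <= l -> exists t, x = c t.
Proof.
move=> ax h; have [t [_ e]] := axis_disp ax x; exists t.
by apply: mdist_positivity; have := mdist_ge0 x (c t); lra.
Qed.

Lemma axisE g l c : is_axis g l c -> axis T g = range c.
Proof.
move=> ax; apply/seteqP; split=> x; rewrite /axis /= (axis_tl ax).
  by move=> h; have [|t ->] := axis_mem (x := x) ax; [rewrite h|exists t].
by case=> t _ <-; exact: axis_dist ax.
Qed.

Lemma axis_zpow g l c n t : is_axis g l c -> act (zpow g n) (c t) = c (t + n%:~R * l).
Proof.
move=> [l0 hc hg].
have hV (r : R) : act g^-1%g (c r) = c (r - l) by rewrite -{1}(subrK l r) -hg actK.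
elim: n t => [|n IH|n IH] t; first by rewrite zpow0 gt_act1 mul0r addr0.
  by rewrite -addn1 PoszD zpowS gt_actM hg IH intrD mulrDl mul1r; congr c; lra.
have -> : (- n.+1%:Z = - n%:Z - 1)%R by lia.
by rewrite zpowB1 gt_actM hV IH intrB mulrBl mul1r; congr c; lra.
Qed.

(** Commuting with [g], the element [s] preserves the points of least displacement, that is, the
    axis, and respects the shift by [l]. *)
Lemma axis_fixed g l c s y : is_axis g l c -> (s * g = g * s)%g ->
  act s y = y -> forall t, act s (c t) = c t.
Proof.
move=> ax sg sy t; have [l0 hc hg] := ax.
have [t0 ht0] := isoline_proj rt y hc.
have [r hr] : exists r, act s (c t) = c r.
  apply: (axis_mem ax).
  by rewrite -gt_actM -sg gt_actM gt_act_isometry (axis_dist _ ax).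
have hr' : act s (c (t + l)) = c (r + l) by rewrite -hg -gt_actM sg gt_actM hr hg.
have D u : d y (act s u) = d y u by rewrite -{1}sy gt_act_isometry.
have := D (c t); have := D (c (t + l)).
(* Distances from [y] give [|r - t0| = |t - t0|] and the same with [l] added inside both absolute
   values; as [l > 0], reflecting [t] in [t0] is excluded unless [t = t0]. *)
rewrite hr hr' !(ht0 r) !(ht0 t) (ht0 (r + l)) (ht0 (t + l)).
move=> /addrI h1 /addrI h2; congr c.
move: h1 h2; have [r0|r0] := leP 0 (r - t0); have [q0|q0] := leP 0 (t - t0);
have [r1|r1] := leP 0 (r + l - t0); have [q1|q1] := leP 0 (t + l - t0);
rewrite ?(ger0_norm r0) ?(ger0_norm q0) ?(ger0_norm r1) ?(ger0_norm q1)
  ?(ltr0_norm r0) ?(ltr0_norm q0) ?(ltr0_norm r1) ?(ltr0_norm q1); lra.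
Qed.

End Axis.

(** * Elliptic elements and commensuration *)

Lemma norm_cases (R : realType) (x : R) :
  (0 <= x /\ `|x| = x) \/ (x < 0 /\ `|x| = - x).
Proof.
by have [h|h] := leP 0 x; [left; rewrite ger0_norm|right; rewrite ltr0_norm].
Qed.

Lemma int_mul1 (m n : int) : m * n = 1 -> m = 1 \/ m = - 1.
Proof.
by move=> h; have /eqP := congr1 absz h; rewrite abszM muln_eq1 => /andP[/eqP]; lia.
Qed.

(** A substitute for ellipticity that mentions no tree, so that it can be carried from one tree in D
    to another and is invariant under automorphisms. *)
Definition commensurating (G : groupType) (s : G) : Prop :=
  forall x : G, exists p q : int,
    [/\ p != 0, q != 0 & (x * zpow s p * x^-1)%g = zpow s q].

Section Elliptic.
Variables (R : realType) (G : groupType) (T : gtree R G).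
Implicit Types (x y z u v w : T) (g h s : G) (l : R) (c : R -> T).

(** An element fixing an interior point of an edge preserves the edge, and then fixes its ends since
    there are no inversions. *)
Lemma fixed_vtx s x : act s x = x -> exists2 v : T, vtx v & act s v = v.
Proof.
move=> sx; have [vx|nx] := pselect (vtx x); first by exists x.
have [u [v [e hx]]] := nonvtx_edge nx.
have [vu vv] := edge_vtx e.
have hx' : segment (act s u) (act s v) x by rewrite -[X in segment _ _ X]sx act_seg.
have [[e1 _]|[e1 e2]] := edge_interior e (act_edge s e) nx hx hx'.
  by exists u.
by case: (gt_act_noinv (g := s) e).
Qed.

(** Walk from [v] to [w]: each edge group is a nontrivial subgroup of a cyclic vertex group, hence
    of finite index, so crossing an edge only costs passing to a further power. *)
Lemma power_fixes_vtx s v w : in_D T -> vtx v -> vtx w -> act s v = v ->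
  exists2 p : int, p != 0 & act (zpow s p) w = w.
Proof.
move=> [_ hv he] vv vw sv.
apply: (vtx_ind (P := fun w => exists2 p : int, p != 0 & act (zpow s p) w = w) vv vw).
  by exists 1.
move=> a b [p p0 hp] e; have [va vb] := edge_vtx e.
have [al [_ _ gen _]] := infinite_cyclicP (hv a va).
have [ga [[ga1 ga2] _ _ ginj]] := infinite_cyclicP (he _ _ e).
have [m hm] := gen _ hp; have [k hk] := gen ga ga1.
exists (p * k).
  rewrite mulf_neq0 //; apply/eqP => k0.
  by have := ginj 1; rewrite zpow1 hk k0 zpow0 => /(_ erefl).
by rewrite zpowM hm -zpowM mulrC zpowM -hk act_fix_zpow.
Qed.

(** The stabilizer of [g v] is cyclic and contains both a power [s^p] and [g s g^-1]. Writing them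
    as [be^k] and [be^m] gives [g s^k g^-1 = s^(p m)]. *)
Lemma elliptic_commensurating s x : in_D T -> act s x = x -> commensurating s.
Proof.
move=> hT sx g; have [v vv sv] := fixed_vtx sx.
(* For trivial [s] the exponents [k] and [m] found below would be zero. *)
have [s1|/eqP s1] := eqVneq s 1%g.
  by exists 1, 1; rewrite s1 !zpow1 mulg1 mulgV.
have [_ hv _] := hT.
have [b [_ _ bgen binj]] := infinite_cyclicP (hv v vv).
have [i hi] := bgen s sv.
have vgv : vtx (act g v) by rewrite act_vtx.
have [p p0 hp] := power_fixes_vtx hT vv vgv sv.
have [be [_ _ gen inj]] := infinite_cyclicP (hv _ vgv).
have [k hk] := gen _ hp.
have [|m hm] := gen (g * s * g^-1)%g.
  by rewrite /= gt_actM actK gt_actM sv.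
exists k, (p * m); split.
- apply/eqP => k0; move: hk; rewrite k0 zpow0 hi -zpowM => /binj/eqP.
  rewrite mulf_eq0 (negPf p0) orbF => /eqP i0; apply: s1.
  by rewrite hi i0.
- rewrite mulf_neq0 //; apply/eqP => m0; apply: s1.
  by apply: (mulgI g); apply: (mulIg g^-1%g); rewrite hm m0 mulg1 mulgV.
- by rewrite -zpow_conj hm (zpowM s p m) hk -!zpowM mulrC.
Qed.

(** From [g s^p g^-1 = s^q], the displacement [|p| l] of [g (c t)] under [s^q] is at least [|q| l].
    The same at [g^-1 (c t)] gives the reverse inequality, and equality forces [g (c t)] onto the
    axis. *)
Lemma commensurating_axis s l c g t : is_axis s l c -> commensurating s ->
  exists r, act g (c t) = c r.
Proof.
move=> ax cs; have [l0 hc _] := ax; have [p [q [p0 q0 e]]] := cs g.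
have e' y : act (zpow s q) (act g y) = act g (act (zpow s p) y).
  by rewrite -e -!gt_actM; congr (gt_act _ _); rewrite mulgVK.
have nz (n : int) : n != 0 -> n%:~R * l != 0 by move=> n0; rewrite mulf_neq0 ?intr_eq0 // gt_eqF.
have D n (n0 : n != 0) := disp_line hc (nz n n0) (fun t => axis_zpow n t ax).
have [t1 [_ h1]] := D q q0 (act g (c t)).
have [t2 [_ h2]] := D p p0 (act g^-1%g (c t)).
have a1 : d (act g (c t)) (act (zpow s q) (act g (c t))) = `|p%:~R * l|.
  by rewrite e' gt_act_isometry (axis_zpow _ _ ax) hc opprD addrA subrr sub0r normrN.
have a2 : d (act g^-1%g (c t)) (act (zpow s p) (act g^-1%g (c t))) = `|q%:~R * l|.
  rewrite -(gt_act_isometry g) -e' actVK (axis_zpow _ _ ax) hc.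
  by rewrite opprD addrA subrr sub0r normrN.
exists t1; apply: mdist_positivity.
have := mdist_ge0 (act g (c t)) (c t1); have := mdist_ge0 (act g^-1%g (c t)) (c t2).
by rewrite a1 in h1; rewrite a2 in h2; lra.
Qed.

Lemma commensurating_line s l c : in_D T -> is_axis s l c -> commensurating s ->
  forall x, exists t, x = c t.
Proof.
move=> [min _ _] ax cs x; have [_ hc _] := ax.
have : range c = setT.
  apply: min; first by exists (c 0); exists 0.
    move=> g _ [t _ <-]; have [r ->] := commensurating_axis g t ax cs.
    by exists r.
  have conv a b : a <= b -> segment (c a) (c b) `<=` range c.
    by move=> ab z /(isoline_seg (gt_rtree T) hc ab)[r _ ->]; exists r.
  move=> _ _ [a _ <-] [b _ <-]; have [ab|ba] := leP a b; first exact: conv.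
  by move=> z /seg_sym; apply: conv; exact: ltW.
by move/seteqP => [_ /(_ x I)] [t _ <-]; exists t.
Qed.

End Elliptic.

(** * Groups in D acting on a line *)

Section Line.
Variables (R : realType) (G : groupType) (T : gtree R G).
Variables (c : R -> T) (l : R) (s : G).
Hypotheses (hT : in_D T) (ax : is_axis s l c) (surj : forall x, exists t, x = c t).
Implicit Types (x y : G) (k : R).
Let hc : isoline c. Proof. by case: ax. Qed.
Let cinj a b : c a = c b -> a = b. Proof. exact: isoline_inj. Qed.

Let tr x k := forall t, act x (c t) = c (t + k).
Let rf x k := forall t, act x (c t) = c (k - t).

Let tr_or_rf x : (exists k, tr x k) \/ (exists k, rf x k).
Proof.
have /choice[f hf] t : exists r, act x (c t) = c r by exact: surj.
have iso a b : `|f a - f b| = `|a - b| by rewrite -!hc -!hf gt_act_isometry.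
have D t : f t = f 0 + t \/ f t = f 0 - t.
  have := iso t 0; rewrite subr0.
  case: (norm_cases t) => -[u ->]; case: (norm_cases (f t - f 0)) => -[v ->] e;
    [left|right|right|left]; lra.
(* So far the sign may depend on [t]; comparison with the value at 1 makes it uniform. *)
have E t : (f 1 = f 0 + 1 -> f t = f 0 + t) /\ (f 1 = f 0 - 1 -> f t = f 0 - t).
  split=> h; case: (D t) => // h'; have := iso t 1; rewrite h h' => e;
  move: e; [case: (norm_cases (f 0 - t - (f 0 + 1)))|
            case: (norm_cases (f 0 + t - (f 0 - 1)))] => -[u ->];
  case: (norm_cases (t - 1)) => -[v ->]; lra.
have [h|h] := D 1; [left|right]; exists (f 0) => t; rewrite hf.
  by rewrite (E t).1 // addrC.
by rewrite (E t).2.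
Qed.

Let trM x y k m : tr x k -> tr y m -> tr (x * y)%g (k + m).
Proof. by move=> hx hy t; rewrite gt_actM hy hx; congr c; lra. Qed.

Let tr1 : tr 1%g 0. Proof. by move=> t; rewrite gt_act1 addr0. Qed.

Let trV x k : tr x k -> tr x^-1%g (- k).
Proof. by move=> hx t; rewrite -{1}(subrK k t) -hx actK. Qed.

Let trX x k n : tr x k -> tr (zpow x n) (n%:~R * k).
Proof.
move=> hx; elim: n => [|n IH|n IH]; first by rewrite zpow0 mul0r.
  by rewrite -addn1 PoszD zpowS intrD mulrDl mul1r; exact: trM.
have -> : (- n.+1%:Z = - n%:Z - 1)%R by lia.
by rewrite zpowB1 intrB mulrBl mul1r; apply: trM => //; exact: trV.
Qed.

Let tr_inj x k m : tr x k -> tr x m -> k = m.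
Proof. by move=> h1 h2; have := h1 0; rewrite h2 !add0r => /cinj. Qed.

Let tr_rf x y k m : tr x k -> rf y m -> rf (x * y)%g (k + m).
Proof. by move=> hx hy t; rewrite gt_actM hy hx; congr c; lra. Qed.

Let rf_rf x y k m : rf x k -> rf y m -> tr (x * y)%g (k - m).
Proof. by move=> hx hy t; rewrite gt_actM hy hx; congr c; lra. Qed.

Let rfV x k : rf x k -> rf x^-1%g k.
Proof.
move=> hx t; have -> : t = k - (k - t) by lra.
by rewrite -hx actK; congr c; lra.
Qed.

Let rf_ntr x k m : rf x k -> tr x m -> False.
Proof.
move=> h1 h2; have := h1 0; have := h1 1; rewrite !h2 => /cinj e1 /cinj e2; lra.
Qed.

(** An element fixing both ends of an edge acts trivially on the line, so the kernel of the action
    is an edge stabilizer. *)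
Let kernel_gen : exists k0 : G, [/\ tr k0 0,
  forall y, tr y 0 -> exists n, y = zpow k0 n & forall n, zpow k0 n = 1%g -> n = 0].
Proof.
have [_ hv he] := hT.
have [v vv] := vtx_ex T.
have vsv : v <> act s v.
  have [t ->] := surj v; have [l0 _ ->] := ax => /cinj; lra.
have [|w e _] := vtx_step vv _ vsv; first by rewrite act_vtx.
have [k0 [[h1 h2] _ gen inj]] := infinite_cyclicP (he _ _ e).
have [a ea] := surj v; have [b eb] := surj w.
have ab : a <> b by move=> ab; apply: (edge_neq e); rewrite ea eb ab.
exists k0; split=> //.
  rewrite ea in h1; rewrite eb in h2.
  have [[k hk]|[k hk]] := tr_or_rf k0.
    by move: h1; rewrite hk => /cinj h1; have <- : k = 0 by lra.
  by exfalso; move: h1 h2; rewrite !hk => /cinj h1 /cinj h2; apply: ab; lra.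
move=> y hy; apply: gen; split; first by rewrite ea hy addr0.
by rewrite eb hy addr0.
Qed.

(** Translation lengths are discrete because a translation moves the vertex [v] to a vertex, and
    only finitely many vertices lie between [v] and [s v]. *)
Let min_tr : exists a k, [/\ 0 < k, tr a k &
  forall y m, tr y m -> exists n : int, m = n%:~R * k].
Proof.
have [l0 _ hs] := ax.
have [v vv] := vtx_ex T; have [t0 et0] := surj v.
have [_ _ _ _ fin] := gt_tree T.
have := fin (c t0) (c (t0 + l)); rewrite -et0 -hs -et0 => /(_ vv).
move=> /(_ ((act_vtx s v).2 vv)) /finite_seqP[L hL].
pose good (z : T) := `[< exists a k, [/\ 0 < k, tr a k & z = c (t0 + k)] >].
have inL a k : 0 < k <= l -> tr a k -> c (t0 + k) \in [seq z <- L | good z].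
  move=> hk ta; rewrite mem_filter; apply/andP; split.
    by apply/asboolP; exists a, k; split=> //; lra.
  have : (segment v (act s v) `&` vtx) (c (t0 + k)).
    split; last by rewrite -ta -et0 act_vtx.
    by rewrite et0 hs; apply: isoline_mem => //; lra.
  by rewrite hL.
have lk : 0 < l <= l by rewrite l0 lexx.
have sL := inL s l lk hs.
have [w wL wmin] := seq_argmin (d v) sL.
move: wL; rewrite mem_filter => /andP[/asboolP[a [k [k0 ta ew]]] _].
(* Euclidean division of [m] by [k]: a positive remainder would be a translation length smaller than
   [k]. *)
exists a, k; split=> // y m ty; exists (Num.floor (m / k)).
have /andP[h1 h2] := floor_itv (m / k).
move: (Num.floor (m / k)) h1 h2 => n h1 h2.
rewrite ler_pdivlMr // in h1; rewrite ltr_pdivrMr // intrD mulrDl mul1r in h2.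
apply/eqP; rewrite eq_le h1 andbT leNgt; apply/negP => lt.
have kl : k <= l.
  have := wmin _ sL; rewrite ew et0 !hc.
  by rewrite !opprD !addrA subrr !sub0r !normrN !gtr0_norm.
have ty' : tr (y * zpow a (- n))%g (m + (- n)%:~R * k) by apply: trM => //; exact: trX.
rewrite intrN mulNr in ty'.
have bd : 0 < m - n%:~R * k <= l by lra.
have := wmin _ (inL _ _ bd ty'); rewrite ew et0 !hc.
rewrite [- (t0 + k)]opprD [- (t0 + (m - _))]opprD !addrA subrr !sub0r.
by rewrite !normrN !gtr0_norm; lra.
Qed.

(** The group is an extension of the cyclic group of translation lengths by the cyclic kernel, and
    conjugation by [a] sends the generator of the kernel to itself or its inverse. *)
Let translation_case : (forall x, exists k, tr x k) -> iso_BS1 1 G \/ iso_BS1 (- 1) G.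
Proof.
move=> all; have [k0 [k0t k0g k0i]] := kernel_gen.
have [a [k [kp ta amin]]] := min_tr.
have tak x : tr x 0 -> tr (a * x * a^-1)%g 0.
  move=> hx; have := trM (trM ta hx) (trV ta).
  by have -> : k + 0 - k = 0 by lra.
have tak' x : tr x 0 -> tr (a^-1 * x * a)%g 0.
  move=> hx; have := trM (trM (trV ta) hx) ta.
  by have -> : - k + 0 + k = 0 by lra.
have [e he] := k0g _ (tak _ k0t); have [e' he'] := k0g _ (tak' _ k0t).
have ee : e * e' = 1.
  have h : k0 = zpow k0 (e * e').
    by rewrite zpowM -he zpow_conj -he' !mulgA mulgK mulgV mul1g.
  apply/eqP; rewrite -subr_eq0; apply/eqP; apply: k0i.
  by rewrite zpowD -h zpowN1 mulgV.
have e1 : e = 1 \/ e = - 1 by exact: int_mul1 ee.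
suff H : iso_BS1 e G by case: e1 => <-; [left|right].
apply: (presented_BS1 e1 he) => [x|m n h].
  have [m tm] := all x; have [n en] := amin x m tm.
  have [i hi] : exists i, (x * zpow a (- n))%g = zpow k0 i.
    apply: k0g; have := trM tm (trX (- n) ta).
    by rewrite intrN mulNr -en subrr.
  by exists i, n; rewrite -hi zpowN mulgVK.
have := trM (trX m k0t) (trX n ta); rewrite h mulr0 add0r => /(tr_inj tr1)/eqP.
rewrite eq_sym mulf_eq0 intr_eq0 [k == 0]gt_eqF // orbF => /eqP n0.
by split=> //; apply: k0i; move: h; rewrite n0 zpow0 mulg1.
Qed.

Let rfX x k n : rf x k ->
  (~~ odd `|n|%N -> tr (zpow x n) 0) /\ (odd `|n|%N -> rf (zpow x n) k).
Proof.
move=> hx.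
have ev (m : int) : tr (zpow x (2 * m)) 0.
  have h2 : tr (zpow x 2) 0.
    by have := rf_rf hx hx; rewrite subrr /= expg2.
  by rewrite zpowM; have := trX m h2; rewrite mulr0.
split=> od.
  have -> : n = 2 * (n %/ 2)%Z by lia.
  exact: ev.
have -> : n = 2 * (n %/ 2)%Z + 1 by lia.
by rewrite zpowS; have := tr_rf (ev (n %/ 2)%Z) hx; rewrite add0r.
Qed.

(** The generator of the stabilizer of the centre of [x] is itself a reflection, and the elements
    acting trivially are its even powers. *)
Let reflection_root x k : rf x k -> exists b, [/\ rf b k,
  forall y, tr y 0 -> exists n, y = zpow b (2 * n),
  exists n, x = zpow b n & forall n, zpow b n = 1%g -> n = 0].
Proof.
move=> hx; set w := c (k / 2).
have xw : act x w = w by rewrite /w hx; congr c; lra.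
(* Were the centre inside an edge, [x] would invert that edge or fix both of its ends; a reflection
   has a single fixed point. *)
have vw : vtx w.
  apply: contrapT => nw; have [u [v [e hw]]] := nonvtx_edge nw.
  have hw' : segment (act x u) (act x v) w by rewrite -[X in segment _ _ X]xw act_seg.
  have [[e1 e2]|[e1 e2]] := edge_interior e (act_edge x e) nw hw hw'; last first.
    by case: (gt_act_noinv (g := x) e).
  have [a ea] := surj u; have [b eb] := surj v.
  rewrite ea hx in e1; rewrite eb hx in e2.
  apply: (edge_neq e); rewrite ea eb; congr c.
  by move: e1 e2 => /cinj e1 /cinj e2; lra.
have [_ hv _] := hT; have [b [bw _ gen inj]] := infinite_cyclicP (hv w vw).
have [n hn] := gen x xw.
have hb : rf b k.
  have [[m hm]|[m hm]] := tr_or_rf b.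
    move: bw; rewrite /w /= hm => /cinj m0.
    have {}m0 : m = 0 by lra.
    have := trX n hm; rewrite m0 mulr0 -hn => h.
    by case: (rf_ntr hx h).
  by move: bw; rewrite /w /= hm => /cinj m0; have <- : m = k by lra.
exists b; split=> //; last by exists n.
move=> y hy; have [|i hi] := gen y; first by rewrite /= /w hy addr0.
have [od|ev] := boolP (odd `|i|%N).
  by have := (rfX i hb).2 od; rewrite -hi => h; case: (rf_ntr h hy).
by exists (i %/ 2)%Z; rewrite hi; congr zpow; lia.
Qed.

(** Two reflections [b] and [e] with adjacent centres have squares generating the kernel, which
    gives the form [b^2 = e^2] of the Klein bottle group; [e b^-1] and [b] are the generators for
    BS(1, -1). *)
Let reflection_case x k : rf x k -> iso_BS1 (- 1) G.
Proof.
move=> hx; have [b [hb bg _ bi]] := reflection_root hx.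
have [a [t [tp ta amin]]] := min_tr.
have hab := tr_rf ta hb.
have [b' [hb' bg' _ bi']] := reflection_root hab.
have tb : tr (zpow b 2) 0 by apply: (rfX 2 hb).1.
have tb' : tr (zpow b' 2) 0 by apply: (rfX 2 hb').1.
have [n hn] := bg' _ tb; have [m hm] := bg _ tb'.
have nm : n * m = 1.
  have h : zpow b' 2 = zpow b' (2 * n * m).
    by rewrite hm zpowM hn -zpowM.
  have := bi' (2 * n * m - 2); rewrite zpowD -h zpowN mulgV => /(_ erefl); lia.
have n1 : n = 1 \/ n = - 1 by exact: int_mul1 nm.
(* As [n] is 1 or -1, this power of [b'] is still a generator, with the sign adjusted so that its
   square is [b^2] and not the inverse of it. *)
pose e := zpow b' n.
have he : rf e (t + k) by apply: (rfX n hb').2; case: n1 => ->.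
have ee : (e * e)%g = (b * b)%g.
  by rewrite -!expg2 -[LHS]/(zpow e 2) -[RHS]/(zpow b 2) hn -zpowM mulrC.
pose a' := (e * b^-1)%g.
have ha' : tr a' t by have := rf_rf he (rfV hb); rewrite addrK.
apply: (presented_BS1 (a := a') (t := b)); first by right.
- rewrite zpowN1 /a' invgM invgK !mulgA.
  have -> : e^-1%g = (e * b^-1 * b^-1)%g.
    apply: (mulgI e); rewrite mulgV !mulgA ee mulgK mulgV //.
  by rewrite !mulgA.
- move=> y; have [[i hy]|[i hy]] := tr_or_rf y.
    have [j hj] := amin _ _ hy.
    have [q hq] : exists q, (zpow a' (- j) * y)%g = zpow b (2 * q).
      apply: bg; have := trM (trX (- j) ha') hy.
      by rewrite intrN mulNr -hj addNr.
    by exists j, (2 * q); rewrite -hq zpowN mulVKg.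
  have hyb := rf_rf hy (rfV hb); have [j hj] := amin _ _ hyb.
  have [q hq] : exists q, (zpow a' (- j) * (y * b^-1))%g = zpow b (2 * q).
    apply: bg; have := trM (trX (- j) ha') hyb.
    by rewrite intrN mulNr -hj addNr.
  by exists j, (2 * q + 1); rewrite zpowS -hq zpowN !mulgA mulgV mul1g mulgVK.
- move=> i j h; have hi := trX i ha'.
  have [od|ev] := boolP (odd `|j|%N).
    by have := tr_rf hi ((rfX j hb).2 od); rewrite h => r; case: (rf_ntr r tr1).
  have := trM hi ((rfX j hb).1 ev); rewrite h addr0 => /(tr_inj tr1)/eqP.
  rewrite eq_sym mulf_eq0 intr_eq0 [t == 0]gt_eqF // orbF => /eqP i0.
  by split=> //; apply: bi; move: h; rewrite i0 zpow0 mul1g.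
Qed.

Lemma line_BS1 : iso_BS1 1 G \/ iso_BS1 (- 1) G.
Proof.
have [[x [k hx]]|no] := pselect (exists x k, rf x k).
  by right; exact: reflection_case hx.
apply: translation_case => x; have [//|[k hk]] := tr_or_rf x.
by case: no; exists x, k.
Qed.

End Line.

Lemma commensurating_elliptic (R : realType) (G : groupType) (T : gtree R G) (s : G) :
  non_solvable G -> in_D T -> commensurating s -> exists x : T, act s x = x.
Proof.
move=> [_ _ _ ns] hT cs; apply: contrapT => nofix.
have [l [c ax]] : exists l c, is_axis (T := T) s l c.
  by apply: is_axis_ex => x sx; apply: nofix; exists x.
have [] := line_BS1 hT ax (commensurating_line hT ax cs).
  exact: ns.
exact: ns.
Qed.

(** * Finite generation *)

Section Generated.
Variables (G : groupType) (F : set G).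

(** The impredicative form of the generated subgroup doubles as an induction principle. *)
Definition generated (x : G) : Prop := forall P : G -> Prop,
  P 1%g -> (forall y z, P y -> P z -> P (y * z)%g) ->
  (forall y, P y -> P y^-1%g) -> (forall y, F y -> P y) -> P x.

Lemma generated1 : generated 1%g. Proof. by move=> P. Qed.

Lemma generatedM x y : generated x -> generated y -> generated (x * y)%g.
Proof.
by move=> hx hy P P1 PM PV PF; have := PM x y; apply; [exact: (hx P)|exact: (hy P)].
Qed.

Lemma generatedV x : generated x -> generated x^-1%g.
Proof. by move=> hx P P1 PM PV PF; apply: (PV); apply: hx. Qed.

Lemma generated_mem x : F x -> generated x.
Proof. by move=> Fx P _ _ _; apply. Qed.

Lemma generated_zpow x n : generated x -> generated (zpow x n).
Proof.
move=> hx; elim: n => [|n IH|n IH]; first exact: generated1.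
  by rewrite -addn1 PoszD zpowS; exact: generatedM.
have -> : (- n.+1%:Z = - n%:Z - 1)%R by lia.
by rewrite zpowB1; apply: generatedM => //; exact: generatedV.
Qed.

Definition generated_pred : {pred G} := [pred x | `[< generated x >]].
Definition generated_group := {x : G | generated_pred x}.

Lemma generated_closed : group_closed generated_pred.
Proof.
split; first by apply/asboolP; exact: generated1.
move=> x y /asboolP hx /asboolP hy; apply/asboolP.
by apply: generatedM => //; exact: generatedV.
Qed.

HB.instance Definition _ := SubChoice.on generated_group.
HB.instance Definition _ :=
  SubChoice_isSubGroup.Build G generated_pred generated_group generated_closed.

Definition to_generated x (hx : generated x) : generated_group :=
  exist _ x (asboolT hx).

Lemma val_generated (x : generated_group) : generated (val x).
Proof. by case: x => x /= /asboolP. Qed.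

End Generated.

Definition finitely_generated (G : groupType) : Prop :=
  exists F : seq G, forall x, generated [set` F] x.

(** The universal property maps [G] to the subgroup [K] generated by the vertex generators and the
    stable letters. Followed by the inclusion, this map agrees with the identity by uniqueness, so
    [K] is all of [G]. *)
Lemma GBS_finitely_generated (G : groupType) : GBS G -> finitely_generated G.
Proof.
case=> Y [S [hv _ _ [j [t [[tS rel] univ]]]]].
have gen (v : gog_V Y) : {b : gog_vgrp v | forall x, exists n, x = zpow b n}.
  apply: cid; have [b [_ _ h _]] := infinite_cyclicP (hv v).
  by exists b => x; exact: h.
pose b (v : gog_V Y) := sval (gen v).
have hb (v : gog_V Y) x : exists n, x = zpow (b v) n by exact: (svalP (gen v)).
pose F := [seq j v (b v) | v <- enum (gog_V Y)] ++ [seq t e | e <- enum (gog_E Y)].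
exists F; set K := generated_group [set` F].
have jK (v : gog_V Y) x : generated [set` F] (j v x).
  have [n ->] := hb v x.
  rewrite (zpow_morph_eq (f := j v)); last exact: gmulfM.
  apply: generated_zpow; apply: generated_mem; change (j v (b v) \in F); rewrite mem_cat; apply/orP; left.
  by apply/mapP; exists v => //; rewrite mem_enum.
have tK (e : gog_E Y) : generated [set` F] (t e).
  apply: generated_mem; change (t e \in F); rewrite mem_cat; apply/orP; right.
  by apply/mapP; exists e => //; rewrite mem_enum.
pose j0 (v : gog_V Y) (x : gog_vgrp v) : K := to_generated (jK v x).
have j0M (v : gog_V Y) : {morph @j0 v : x y / (x * y)%g}.
  by move=> x y; apply: val_inj; rewrite valM /= gmulfM.
pose j' (v : gog_V Y) : {multiplicative gog_vgrp v -> K} :=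
  HB.pack (@j0 v) (isMultiplicative.Build _ _ _ (j0M v)).
have [|phi [hj ht _]] := univ K j' (fun e => to_generated (tK e)).
  split=> [e eS|e c]; apply: val_inj.
    by rewrite /= tS.
  by have := rel e c; rewrite !valM /=.
have [|psi [_ _ uq]] := univ G j t; first by split.
have vM : {morph (fun x => val (phi x) : G) : x y / (x * y)%g}.
  by move=> x y; rewrite gmulfM valM.
pose vphi : {multiplicative G -> G} :=
  HB.pack (fun x => val (phi x) : G) (isMultiplicative.Build _ _ _ vM).
have e1 : vphi =1 psi.
  by apply: uq => [v x|e] /=; rewrite ?hj ?ht.
have e2 : (idfun : {multiplicative G -> G}) =1 psi by apply: uq.
by move=> x; have := e2 x; rewrite -e1 /= => ->; exact: val_generated.
Qed.

(** * Local finiteness *)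

Section LocallyFinite.
Variables (R : realType) (G : groupType) (T : gtree R G).
Implicit Types (x y z u v w p q a b : T) (g h s f : G).
Let rt := gt_rtree T.

(** No continuity of [H] is involved: only the images of vertices matter, and [seg_union] is
    iterated along the edges. *)
Lemma seg_cover_map (H : T -> T) u v z : vtx u -> vtx v -> u <> v ->
  segment (H u) (H v) z -> exists a b,
    [/\ edge a b, segment u v a, segment u v b & segment (H a) (H b) z].
Proof.
move=> vu vv uv hz.
(* The first alternative starts the induction, where no edge has been crossed yet. *)
pose P w := w = u \/ forall z, segment (H u) (H w) z -> exists a b,
  [/\ edge a b, segment u v a, segment u v b & segment (H a) (H b) z].
suff: P v by case=> [vu'|]; [case: uv|apply].
apply: (vtx_ind_seg (P := P) vu vv); first by left.
move=> a b [->|Pa] e ha hb hab; right; first by move=> y hy; exists u, b.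
by move=> y /(seg_union rt (H a))[/Pa//|h]; exists a, b.
Qed.

Lemma seg_cover u v z : vtx u -> vtx v -> segment u v z -> u <> v ->
  exists a b, [/\ edge a b, segment u v a, segment u v b & segment a b z].
Proof. by move=> vu vv hz uv; exact: (seg_cover_map (H := id) vu vv uv hz). Qed.

Lemma edge_sub_seg u v p q x : edge u v -> vtx p -> vtx q -> ~ vtx x ->
  segment u v x -> segment p q x -> segment p q u /\ segment p q v.
Proof.
move=> e vp vq nx hu hp.
have pq : p <> q by move=> pq; move: hp; rewrite -pq => /segxx xp; rewrite xp in nx.
have [a [b [e' ha hb hx]]] := seg_cover vp vq hp pq.
by have [[-> ->]|[-> ->]] := edge_interior e' e nx hx hu.
Qed.

Lemma edge_midpoint u v : edge u v -> exists2 m, segment u v m & ~ vtx m.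
Proof.
move=> e; have [m hm dm] := midpoint rt u v; have e0 := edge_gt0 e.
exists m => // vm; have [mu|mv] := edge_seg_vtx e hm vm.
  by move: dm; rewrite mu mdistxx; lra.
by move: dm; rewrite mv; lra.
Qed.

(** Elements sending [a] to [v] have the form [h0 be^i], and [be^k] generates the edge group, so the
    image of [b] depends only on [i] modulo [k]. *)
Lemma finite_neighbours v a b : in_D T -> edge a b ->
  finite_set [set w | exists h, act h a = v /\ act h b = w].
Proof.
move=> [_ hv he] e; have [va vb] := edge_vtx e.
have [[h0 h0a]|no] := pselect (exists h, act h a = v); last first.
  by apply: (@sub_finite_set _ _ set0) => // w [h [ha _]]; case: no; exists h.
have [be [_ _ gen inj]] := infinite_cyclicP (hv a va).
have [ga [[ga1 ga2] _ _ ginj]] := infinite_cyclicP (he a b e).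
have [k hk] := gen ga ga1.
have k0 : k != 0.
  apply/eqP => k0; have := ginj 1; rewrite zpow1 hk k0 zpow0 => /(_ erefl); lia.
pose F (n : nat) := act h0 (act (zpow be n) b).
apply: (@sub_finite_set _ _ [set F n | n in `I_(`|k|%N)]); last first.
  exact/finite_image/finite_II.
move=> w [h [ha hb]].
have [|i hi] := gen (h0^-1 * h)%g.
  by rewrite /= gt_actM ha -h0a actK.
exists `|(i %% k)%Z|%N.
  by rewrite /=; have := ltz_mod i k0; have := modz_ge0 i k0; lia.
rewrite /F gez0_abs ?modz_ge0 //.
have eh : h = (h0 * zpow be i)%g by rewrite -hi mulVKg.
rewrite -hb eh gt_actM; congr (gt_act _ _).
have ei : i = (i %% k)%Z + k * (i %/ k)%Z.
  by have := divz_eq i k; rewrite (mulrC k); lia.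
rewrite {2}ei zpowD gt_actM zpowM -hk.
by rewrite (act_fix_zpow _ ga2).
Qed.

Section Cocompact.
Hypotheses (hT : in_D T) (fg : finitely_generated G).
Variable x0 : T.
Hypothesis vx0 : vtx x0.

(** The translates of the segments from [x0] to its images under generators form a connected
    invariant set, which is the whole tree by minimality. *)
Lemma cocompact : exists F : seq G, forall x : T,
  exists h f, f \in F /\ segment (act h x0) (act h (act f x0)) x.
Proof.
(* The identity is added so that [x0] is covered even when the list of generators is empty. *)
have [F hF] := fg; exists (1%g :: F).
pose Y (x : T) := exists h f, f \in 1%g :: F /\
  segment (act h x0) (act h (act f x0)) x.
suff YT : Y = setT.
  by move=> x; rewrite -/(Y x) YT.
have [min _ _] := hT.
have Yact g x : Y x -> Y (act g x).
  by case=> h [f [Ff hx]]; exists (g * h)%g, f; rewrite !gt_actM act_seg.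
apply: min => //.
  by exists x0, 1%g, 1%g; rewrite mem_head; split=> //; rewrite !gt_act1; exact: segl.
have conn g : segment x0 (act g x0) `<=` Y.
  apply: (hF g (fun g => segment x0 (act g x0) `<=` Y)) => [z|g1 g2 H1 H2 z|g1 H z|f Ff z].
  - rewrite gt_act1 => hz; exists 1%g, 1%g; rewrite mem_head; split=> //.
    by rewrite !gt_act1.
  - rewrite gt_actM => /(seg_union rt (act g1 x0))[/H1//|hz].
    rewrite -(actVK g1 z); apply: Yact; apply: H2.
    by rewrite -(act_seg g1) actVK.
  - move=> hz; rewrite -(actK g1 z); apply: Yact; apply: H.
    by apply: seg_sym; rewrite -(act_seg g1^-1%g) !actK.
  - move=> hz; exists 1%g, f; rewrite inE Ff orbT; split=> //.
    by rewrite !gt_act1.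
have conn2 g1 g2 : segment (act g1 x0) (act g2 x0) `<=` Y.
  move=> z hz; rewrite -(actVK g1 z); apply: Yact; apply: (conn (g1^-1 * g2)%g).
  by rewrite -(act_seg g1) actVK gt_actM actVK.
move=> x y [h [f [Ff hx]]] [h' [f' [Ff' hy]]] z /(seg_union rt (act h x0))[hz|hz].
  by exists h, f; split=> //; exact: segtl hx (seg_sym hz).
have [|hz'] := seg_union rt (act h' x0) hz; first exact: conn2.
by exists h', f'; split=> //; exact: segtl hy hz'.
Qed.

(** The midpoint of an edge lies in a translate of some segment [[x0, f x0]]; that segment then
    contains the translated edge, and has finitely many vertices. *)
Lemma finite_vertex_reps : exists L : seq T, forall u v, edge u v ->
  exists h a b, [/\ a \in L, b \in L, edge a b, u = act h a & v = act h b].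
Proof.
have [F hF] := cocompact.
have fin f : finite_set (segment x0 (act f x0) `&` vtx).
  by have [_ _ _ _] := gt_tree T; apply=> //; rewrite act_vtx.
have : finite_set (\bigcup_(f in [set` F]) (segment x0 (act f x0) `&` vtx)).
  by apply: bigcup_finite => // f _; exact: fin.
move=> /finite_seqP[L hL]; exists L => u v e.
have [m hm nm] := edge_midpoint e; have [h [f [Ff hm']]] := hF m.
have e' := act_edge h^-1%g e.
have [] := edge_sub_seg (x := act h^-1%g m) (p := x0) (q := act f x0) e'.
- by [].
- by rewrite act_vtx.
- by rewrite act_vtx.
- by rewrite act_seg.
- by rewrite -(act_seg h) actVK.
move=> h1 h2; have [v1 v2] := edge_vtx e'.
have inL y : segment x0 (act f x0) y -> vtx y -> y \in L.
  move=> hy vy.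
  have : (\bigcup_(f in [set` F]) (segment x0 (act f x0) `&` vtx)) y by exists f.
  by rewrite hL.
exists h, (act h^-1%g u), (act h^-1%g v); rewrite !actVK.
by split=> //; apply: inL.
Qed.

Lemma edge_length_lb : exists2 e : R, 0 < e & forall u v : T, edge u v -> e <= d u v.
Proof.
have [L hL] := finite_vertex_reps.
have [e e0 he] : exists2 e : R, 0 < e & forall p : T * T,
    p \in [seq (a, b) | a <- L, b <- L] -> edge p.1 p.2 -> e <= d p.1 p.2.
  elim: [seq _ | _ <- _, _ <- _] => [|p s [e e0 IH]]; first by exists 1.
  have [ep|np] := pselect (edge p.1 p.2); last first.
    by exists e => // q; rewrite inE => /orP[/eqP-> //|]; exact: IH.
  have dp := edge_gt0 ep.
  exists (Num.min e (d p.1 p.2)); first by rewrite lt_min e0.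
  move=> q; rewrite inE ge_min => /orP[/eqP-> _|qs eq]; first by rewrite lexx orbT.
  by rewrite IH.
exists e => // u v /hL[h [a [b [aL bL eab -> ->]]]].
rewrite gt_act_isometry; apply: (he (a, b)) => //.
by apply/allpairsP; exists (a, b).
Qed.

Lemma finite_link v : finite_set [set w | edge v w].
Proof.
have [L hL] := finite_vertex_reps.
apply: (@sub_finite_set _ _ (\bigcup_(p in [set` [seq (a, b) | a <- L, b <- L]]
    `&` [set p | edge p.1 p.2]) [set w | exists h, act h p.1 = v /\ act h p.2 = w])).
  move=> w /hL[h [a [b [aL bL eab -> ->]]]]; exists (a, b).
    by split=> //=; apply/allpairsP; exists (a, b).
  by exists h.
apply: bigcup_finite => [|p [_ ep]]; last exact: finite_neighbours.
by apply: finite_setIl; exact: finite_seq.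
Qed.

Lemma finite_ball v M : vtx v -> finite_set [set w | vtx w /\ d v w <= M].
Proof.
move=> vv; have [e e0 he] := edge_length_lb.
(* Radii are measured in multiples of the lower bound [e] on edge lengths: enlarging the radius by
   [e] adds at most the neighbours of vertices already counted. *)
suff H n : finite_set [set w | vtx w /\ d v w <= n%:R * e].
  apply: sub_finite_set (H (Num.bound `|M / e|)) => w [vw h]; split=> //.
  apply: le_trans h _; rewrite -ler_pdivrMr //; apply: le_trans (ler_norm _) _.
  by apply/ltW; exact: archi_boundP (normr_ge0 _).
elim: n => [|n IH].
  apply: (@sub_finite_set _ _ [set v]) => // w [_]; rewrite mul0r => h /=.
  apply: mdist_positivity; have := mdist_ge0 v w; rewrite (metric_sym w v); lra.
apply: (@sub_finite_set _ _ ([set v] `|` \bigcup_(w in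
    [set w | vtx w /\ d v w <= n%:R * e]) [set w' | edge w w'])); last first.
  rewrite finite_setU; split; first exact: finite_set1.
  by apply: bigcup_finite => // w _; exact: finite_link.
move=> w [vw hw]; have [->|/eqP wv] := eqVneq w v; [by left|right].
have [w' ew hw'] := vtx_step vw vv wv.
exists w'; last exact: edge_sym.
split; first by have [] := edge_vtx ew.
have := he _ _ ew; move: hw'; rewrite segE (metric_sym w v) (metric_sym w' v).
by move: hw; rewrite -natr1 mulrDl mul1r; lra.
Qed.

Lemma cobounded : exists L : R, forall x : T, exists h, d x (act h x0) <= L.
Proof.
have [F hF] := cocompact.
exists (\sum_(f <- F) d x0 (act f x0)) => x; have [h [f [Ff hx]]] := hF x.
exists h; rewrite metric_sym; have /andP[_ h1] := seg_le hx.
apply: le_trans h1 _; rewrite gt_act_isometry (big_rem f) //= lerDl.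
by apply: sumr_ge0 => *; exact: mdist_ge0.
Qed.

End Cocompact.
End LocallyFinite.

(** * Pseudo-periodic elements up to pseudo-conjugacy *)

Lemma finite_pigeonhole (A : eqType) (S : set A) (F : nat -> A) :
  finite_set S -> (forall n, S (F n)) -> exists m n, (m < n)%N /\ F m = F n.
Proof.
move=> /finite_seqP[s hs] FS.
apply: contrapT => no.
have u : uniq [seq F n | n <- iota 0 (size s).+1].
  rewrite map_inj_in_uniq ?iota_uniq // => m n _ _ e.
  apply: contrapT => mn; apply: no.
  have : m != n by apply/eqP.
  by rewrite neq_ltn => /orP[h|h]; [exists m, n|exists n, m].
have := uniq_leq_size (s2 := s) u; rewrite size_map size_iota ltnn.
move=> H; suff : false by []; apply: H => x /mapP[n _ ->].
by have := FS n; rewrite hs.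
Qed.

Section Twist.
Variable G : groupType.
Local Open Scope group_scope.

(* Conjugating k b^j by a power of b changes j by a multiple of q - p; when
   p = q the power b^p commutes with k b^j and can be absorbed as s. *)
Lemma twist_classes (k b : G) (p q : int) : p != 0%R ->
  k * zpow b p * k^-1 = zpow b q ->
  exists2 P : int, P != 0%R & forall j j', (P %| (j' - j)%R)%Z ->
    exists u s i, [/\ s = zpow b i,
      k * zpow b j * s = s * (k * zpow b j) &
      k * zpow b j' = u * (k * zpow b j * s) * u^-1].
Proof.
move=> p0 rel.
have relx l : k * zpow b (p * l)%R = zpow b (q * l)%R * k.
  by rewrite !zpowM -rel zpow_conj mulgVK.
have [pq|pq] := eqVneq p q.
  exists p => // j j' /dvdzP[l hl]; exists 1, (zpow b (p * l)%R), (p * l)%R.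
  have cm : zpow b j * zpow b (p * l)%R = zpow b (p * l)%R * zpow b j.
    by rewrite -!zpowD addrC.
  split=> //; first by rewrite -mulgA cm mulgA relx pq mulgA.
  rewrite mul1g invg1 mulg1 -mulgA -zpowD; congr (_ * zpow _ _).
  by rewrite mulrC -hl; lia.
exists (q - p)%R; first by rewrite subr_eq0 eq_sym.
move=> j j' /dvdzP[l hl].
exists (zpow b (q * (- l))%R), 1, 0%R; rewrite zpow0 !mulg1 mul1g; split=> //.
rewrite mulgA -relx -!mulgA -zpowN -!zpowD; congr (_ * zpow _ _).
have -> : j' = (j + l * (q - p))%R by lia.
by rewrite mulrBr !mulrN opprK (mulrC l) (mulrC l); lia.
Qed.

End Twist.

Lemma automorphism_iter (G : groupType) (phi : G -> G) n :
  automorphism phi -> automorphism (iter n phi).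
Proof.
move=> [bij phiM]; elim: n => [|n [bn mn]]; first by split=> //; exists id.
by split; [exact: bij_comp bij bn|move=> x y /=; rewrite mn phiM].
Qed.

Lemma automorphism_inv (G : groupType) (phi : G -> G) x :
  automorphism phi -> phi x^-1%g = (phi x)^-1%g.
Proof.
move=> [_ phiM]; have p1 : phi 1%g = 1%g.
  by apply: (mulgI (phi 1%g)); rewrite -phiM !mulg1.
by apply/esym/mulg1_eq; rewrite -phiM mulgV p1.
Qed.

Lemma automorphism_commensurating (G : groupType) (phi : G -> G) s :
  automorphism phi -> commensurating (phi s) <-> commensurating s.
Proof.
move=> aphi; have [bij phiM] := aphi; have [phi' phiK phi'K] := bij.
split=> cs x.
  have [p [q [p0 q0 e]]] := cs (phi x); exists p, q; split=> //.
  apply: (bij_inj bij); rewrite !phiM automorphism_inv //.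
  by rewrite !(zpow_morph_eq (f := phi)).
have [p [q [p0 q0 e]]] := cs (phi' x); exists p, q; split=> //.
have := congr1 phi e; rewrite !phiM automorphism_inv // phi'K.
by rewrite !(zpow_morph_eq (f := phi)).
Qed.

Section PseudoConj.
Variables (R : realType) (G : groupType) (T : gtree R G).
Hypotheses (hT : in_D T) (fg : finitely_generated G).

(** The extra 1 leaves room because the translation length is defined as an infimum. *)
Lemma small_displacement (g : G) (M : R) : translation_length T g <= M ->
  exists x : T, d x (act g x) <= M + 1.
Proof.
move=> h; apply: contrapT => no.
have : M + 1 <= translation_length T g.
  apply: lb_le_inf; first by have [x _] := vtx_ex T; exists (d x (act g x)), x.
  move=> _ [x _ <-]; rewrite leNgt; apply/negP => lt; apply: no; exists x.
  exact: ltW.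
lra.
Qed.

Lemma bounded_orbit_pseudo_conj (phi : G -> G) (g : G) (M : R) :
  automorphism phi -> (forall n, translation_length T (iter n phi g) <= M) ->
  exists m u s, [/\ (0 < m)%N, commensurating s, (g * s = s * g)%g &
    iter m phi g = (u * (g * s) * u^-1)%g].
Proof.
move=> [bij phiM] bd.
have [x0 vx0] := vtx_ex T.
have [L hL] := cobounded hT fg x0.
have [_ hv _] := hT.
have [b [bx _ gen inj]] := infinite_cyclicP (hv x0 vx0).
have cb : commensurating b := elliptic_commensurating hT bx.
(* Conjugating by [h n] replaces a point of small displacement by [x0] itself, at the cost of [L] on
   either side. *)
have /choice[h hh] : forall n, exists h : G,
    d x0 (act (h^-1 * iter n phi g * h)%g x0) <= M + 1 + 2 * L.
  move=> n; have [x hx] := small_displacement (bd n).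
  have [h hxh] := hL x; exists h.
  rewrite -(gt_act_isometry h) -!gt_actM !mulgA mulgV mul1g gt_actM.
  have := mdist_tri x (act h x0) (act (iter n phi g) (act h x0)).
  have := mdist_tri (act (iter n phi g) x) x (act (iter n phi g) (act h x0)).
  by rewrite gt_act_isometry (metric_sym (act h x0) x); lra.
pose gn n := ((h n)^-1 * iter n phi g * h n)%g.
have gnE k : gn k = ((h k)^-1 * iter k phi g * h k)%g by [].
pose W := [set w : T | vtx w /\ d x0 w <= M + 1 + 2 * L].
have finW : finite_set W := finite_ball hT fg vx0 (M + 1 + 2 * L) vx0.
have inW n : W (act (gn n) x0) by split; [rewrite act_vtx|exact: hh].
clearbody gn.
(* A coset representative for each point of the orbit of [x0]; elsewhere 1 is an arbitrary
   default. *)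
have /choice[ka hka] : forall w : T, exists k : G,
    (exists k', act k' x0 = w) -> act k x0 = w.
  move=> w; have [[k hk]|no] := pselect (exists k, act k x0 = w); first by exists k.
  by exists 1%g.
have /choice[j hj] : forall n, exists j, gn n = (ka (act (gn n) x0) * zpow b j)%g.
  move=> n; have [|j hj] := gen ((ka (act (gn n) x0))^-1 * gn n)%g.
    rewrite /= gt_actM; apply: (@act_inj _ _ _ (ka (act (gn n) x0))).
    by rewrite actVK hka //; exists (gn n).
  by exists j; rewrite -hj mulVKg.
pose good w (P : int) := forall j j', (P %| (j' - j)%R)%Z ->
    exists u s i, [/\ s = zpow b i,
      (ka w * zpow b j * s)%g = (s * (ka w * zpow b j))%g &
      (ka w * zpow b j')%g = (u * (ka w * zpow b j * s) * u^-1)%g].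
have goodW w : exists2 P, P != 0 & good w P.
  by have [p [q [p0 _ rel]]] := cb (ka w); exact: twist_classes rel.
(* One modulus for all of the finitely many [w]: the product of the individual ones. *)
have [P P0 hP] : exists2 P : int, P != 0 & forall w, W w -> good w P.
  have [s ->] := (finite_seqP _).1 finW.
  elim: s => [|w s [P P0 IH]]; first by exists 1.
  have [Q Q0 hQ] := goodW w; exists (P * Q); first exact: mulf_neq0.
  move=> w'; rewrite /= inE => /orP[/eqP->|ws] i i' dv.
    by apply: hQ; apply: dvdz_trans dv; exact: dvdz_mull.
  by apply: (IH w' ws); apply: dvdz_trans dv; exact: dvdz_mulr.
have [|k|n [m [nm [ew ej]]]] := finite_pigeonhole
  (S := W `*` [set (i%:Z : int) | i in `I_(`|P|%N)])
  (F := fun k => (act (gn k) x0, (j k %% P)%Z)).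
- by apply: finite_setX => //; exact/finite_image/finite_II.
- split=> //=; exists `|(j k %% P)%Z|%N.
    by rewrite /=; have := ltz_mod (j k) P0; have := modz_ge0 (j k) P0; lia.
  by rewrite gez0_abs // modz_ge0.
have dv : (P %| (j m - j n)%R)%Z by rewrite -eqz_mod_dvd ej.
have [u [s [i [es cs]]]] := hP _ (inW n) _ _ dv.
rewrite -(hj n) in cs *.
rewrite {1}ew -(hj m) => em.
have an := automorphism_iter n (conj bij phiM).
have [[psi' _ psiK] psiM] := an.
(* Undoing the conjugations gives [phi^m g = K (phi^n g S) K^-1]; taking preimages under [phi^n]
   turns this into a statement about [phi^(m - n) g]. *)
pose K := (h m * u * (h n)^-1)%g; pose S := (h n * s * (h n)^-1)%g.
have eS : iter n phi (psi' S) = S by rewrite psiK.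
have eK : iter n phi (psi' K) = K by rewrite psiK.
have cS : commensurating S.
  apply: (elliptic_commensurating (x := act (h n) x0) hT).
  by rewrite /S es !gt_actM actK (act_fix_zpow _ bx).
have ing : injective (iter n phi) by have [/bij_inj] := an.
have conjg_eq k : iter k phi g = (h k * gn k * (h k)^-1)%g.
  by rewrite gnE !mulgA mulgV mul1g mulgK.
exists (m - n)%N, (psi' K), (psi' S); split; first by rewrite subn_gt0.
- by apply/(automorphism_commensurating _ an); rewrite eS.
- apply: ing; rewrite !psiM eS conjg_eq /S !mulgA !mulgVK.
  by rewrite -(mulgA (h n)) cs !mulgA.
- apply: ing; rewrite -iterD subnKC ?(ltnW nm) // !psiM (automorphism_inv _ an).
  rewrite eS eK !conjg_eq em /K /S !invgM invgK !mulgA !mulgVK //.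
Qed.

End PseudoConj.

(** * Train track maps *)

Section TrainTrack.
Variables (R : realType) (G : groupType) (T : gtree R G) (f : T -> T) (lam : R).
Implicit Types (x y z u v w p q a b : T).
Let rt := gt_rtree T.
Hypothesis lam1 : 1 < lam.
Hypothesis fV : forall v, vtx v -> vtx (f v).
Hypothesis stretch : stretches_edges f lam.
Hypothesis legal : forall u v : T, edge u v -> legal_path f (f u) (f v).

Definition dilates (F : T -> T) (k : R) (u v : T) : Prop :=
  forall x y, segment u v x -> segment u v y -> d (F x) (F y) = k * d x y.

Lemma dilates_seg F k u v z : dilates F k u v -> segment u v z ->
  segment (F u) (F v) (F z).
Proof.
move=> h hz; have ul := segl u v; have ur := segr u v.
by rewrite segE !h // -mulrDr; congr (_ * _).
Qed.

Lemma dilates_surj F k u v z : 0 < k -> dilates F k u v ->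
  segment (F u) (F v) z -> exists2 x, segment u v x & F x = z.
Proof.
move=> k0 h hz; have ul := segl u v; have ur := segr u v.
have /andP[z0 z1] := seg_le hz; rewrite h // in z1.
have [|x hx dx] := rt.1 u v (d (F u) z / k).
  by rewrite divr_ge0 ?(ltW k0) //= ler_pdivrMr // mulrC.
exists x => //; apply: (seg_uniq rt (dilates_seg h hx) hz).
by rewrite h // dx mulrC divfK // gt_eqF.
Qed.

(* If f^n folded the turn at w, the overlap of the images of the two edges
   would have positive length, making the turn illegal. *)
Lemma legal_turn_straight n w a b : (0 < n)%N ->
  dilates (iter n f) (lam ^+ n) w a -> dilates (iter n f) (lam ^+ n) w b ->
  ~ illegal_turn f w a b ->
  segment (iter n f a) (iter n f b) (iter n f w).
Proof.
move=> n0 ha hb nill; have k0 : 0 < lam ^+ n by apply: exprn_gt0; exact: lt_trans ltr01 lam1.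
have [q [q1 q2 q3 _]] := tripod rt (iter n f w) (iter n f a) (iter n f b).
have [<-//|/eqP wq] := eqVneq q (iter n f w).
case: nill; exists n; split=> //; exists (d (iter n f w) q / lam ^+ n).
  rewrite divr_gt0 // mdist_gt0; apply/eqP => e; exact: wq.
move=> x y hx hy exy le.
have dx : d (iter n f w) (iter n f x) = lam ^+ n * d w x by rewrite ha //; exact: segl.
have dy : d (iter n f w) (iter n f y) = lam ^+ n * d w y by rewrite hb //; exact: segl.
have le' : lam ^+ n * d w x <= d (iter n f w) q by rewrite mulrC -ler_pdivlMr.
apply: (seg_uniq rt (x := iter n f w) (y := q)); last by rewrite dx dy exy.
  by apply: (seg_ord rt (dilates_seg ha hx) q1); rewrite dx.
by apply: (seg_ord rt (dilates_seg hb hy) q2); rewrite dy -exy.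
Qed.

(** The images of consecutive edges meet without folding at legal turns, so they concatenate to a
    geodesic by [seg_chain]. *)
Lemma legal_path_dilates n p q : (0 < n)%N ->
  (forall u v, edge u v -> dilates (iter n f) (lam ^+ n) u v) ->
  vtx p -> vtx q -> legal_path f p q -> dilates (iter n f) (lam ^+ n) p q.
Proof.
move=> n0 hE vp vq leg; set F := iter n f; set k := lam ^+ n.
have k0 : 0 < k by apply: exprn_gt0; exact: lt_trans ltr01 lam1.
apply: (vtx_ind_seg (P := fun w => dilates F k p w) vp vq) => [x y|a b Pa e ha hb hab].
  by move=> /segxx -> /segxx ->; rewrite !mdistxx mulr0.
have [va vb] := edge_vtx e.
have [_ pab] := seg_trans ha hab.
have Fpab : segment (F p) (F b) (F a).
  have [->|/eqP pa] := eqVneq p a; first exact: segl.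
  (* Here [a'] is the vertex just before [a], so [a'] and [b] are the two branches of the turn
     crossed at [a]. *)
  have [|a' ea' ha'] := vtx_step va vp _; first by move=> h; apply: pa.
  have straight : segment (F a') (F b) (F a).
    apply: legal_turn_straight => //; [exact: hE|exact: hE|].
    have pa'a := seg_sym ha'.
    apply: leg => //; last exact: segtl ha pa'a.
    move=> a'b; have := edge_gt0 e; rewrite -a'b in pab *.
    move: pab pa'a; rewrite !segE (metric_sym a' a); lra.
  have ne : F a' <> F a.
    move=> h; have := hE _ _ (edge_sym ea') a' a (segl _ _) (segr _ _).
    rewrite -/F h mdistxx; have := edge_gt0 (edge_sym ea') => ? /esym/eqP.
    by rewrite mulf_eq0 !gt_eqF.
  have chain := seg_chain rt (dilates_seg Pa (seg_sym ha')) straight ne.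
  rewrite segE chain.
  by have := dilates_seg Pa (seg_sym ha'); rewrite segE => ->.
have mixed x y : segment p a x -> segment a b y -> d (F x) (F y) = k * d x y.
  move=> hx hy.
  have [_ s1] := seg_trans pab hy.
  have [_ s2] := seg_trans (seg_sym s1) (seg_sym hx).
  have [_ t1] := seg_trans Fpab (dilates_seg (hE _ _ e) hy).
  have [_ t2] := seg_trans (seg_sym t1) (seg_sym (dilates_seg Pa hx)).
  move: s2 t2 => /seg_sym s2 /seg_sym t2; rewrite segE in s2; rewrite segE in t2.
  rewrite -s2 -t2 Pa //; last exact: segr.
  by rewrite (hE _ _ e) //; [rewrite mulrDr|exact: segl].
move=> x y hx hy.
have [hx1|hx1] := seg_union rt a hx; have [hy1|hy1] := seg_union rt a hy.
- exact: (Pa x y hx1 hy1).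
- exact: mixed hx1 hy1.
- by rewrite metric_sym (mixed _ _ hy1 hx1) metric_sym.
- exact: (hE _ _ e x y hx1 hy1).
Qed.

(** The image of an edge under [f] is a legal path, which the remaining iterates dilate by
    induction. Exponent 1 is a separate base case because legality speaks of positive powers
    only. *)
Lemma edge_dilates n u v : edge u v -> dilates (iter n f) (lam ^+ n) u v.
Proof.
elim: n u v => [|[|n] IH] u v e.
- by move=> x y _ _; rewrite expr0 mul1r.
- by move=> x y hx hy; rewrite expr1; exact: stretch e hx hy.
have [vu vv] := edge_vtx e.
have h1 : dilates f lam u v by move=> x y; exact: stretch.
have := legal_path_dilates (ltn0Sn n) IH (fV vu) (fV vv) (legal e).
move=> h x y hx hy; rewrite (iterSr n.+1) (iterSr n.+1) h.
- by rewrite h1 // mulrA -exprSr.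
- exact: dilates_seg h1 hx.
- exact: dilates_seg h1 hy.
Qed.

End TrainTrack.

(** * Enumeration of locally finite periodic subsets of the real line *)

Section Enumeration.
Variable R : realType.
Implicit Types (t a b : R).

Lemma enum_right (P : set R) t0 : P t0 ->
  (forall a b, finite_set [set t | P t /\ a <= t <= b]) ->
  (forall a, exists2 t, P t & a < t) ->
  exists x : nat -> R, [/\ x 0%N = t0, forall n, P (x n), forall n, x n < x n.+1,
    forall n t, x n < t < x n.+1 -> ~ P t &
    forall t, t0 <= t -> exists n, x n <= t < x n.+1].
Proof.
move=> P0 fin unb.
have /choice[nx hnx] : forall a, exists b,
    [/\ P b, a < b & forall t, a < t < b -> ~ P t].
  move=> a; have [b Pb ab] := unb a.
  have [s hs] := (finite_seqP _).1 (fin a b).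
  have bs : b \in [seq t <- s | a < t].
    rewrite mem_filter ab /=; have : [set t | P t /\ a <= t <= b] b.
      by split=> //; rewrite lexx ltW.
    by rewrite hs.
  have [w] := seq_argmin id bs; rewrite mem_filter => /andP[aw ws] wmin.
  have [Pw /andP[_ wb]] : [set t | P t /\ a <= t <= b] w by rewrite hs.
  exists w; split=> // t /andP[at_ tw] Pt.
  have ts : t \in [seq t <- s | a < t].
    rewrite mem_filter at_ /=; have : [set t | P t /\ a <= t <= b] t.
      by split=> //; lra.
    by rewrite hs.
  by have /= := wmin t ts; lra.
pose x n := iter n nx t0.
have xP n : P (x n) by case: n => //= n; have [] := hnx (x n).
have xS n : x n < x n.+1 by have [] := hnx (x n).
have xmono m n : (m < n)%N -> x m < x n.
  elim: n => // n IH; rewrite ltnS leq_eqVlt => /orP[/eqP->|/IH h]; first exact: xS.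
  exact: lt_trans h (xS n).
exists x; split=> // [n t|t t0t]; first by have [_ _] := hnx (x n); apply.
have [n hn] : exists n, t < x n.
  apply: contrapT => no.
  have [n|m [n [mn e]]] := finite_pigeonhole (F := x) (fin t0 t).
  - split=> //; apply/andP; split.
      by case: n => [|n]; [exact: lexx|apply/ltW; exact: (xmono 0%N)].
    by rewrite leNgt; apply/negP => h; apply: no; exists n.
  - by have := xmono _ _ mn; rewrite e ltxx.
have ex : exists n, t < x n by exists n.
case: (ex_minnP ex) => -[|m] hm mmin; first by move: hm; rewrite /x /=; lra.
exists m; rewrite hm andbT leNgt; apply/negP => h.
by have := mmin m h; rewrite ltnn.
Qed.

Lemma enum_int (P : set R) (l : R) : P !=set0 -> 0 < l ->
  (forall t, P t <-> P (t + l)) ->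
  (forall a b, finite_set [set t | P t /\ a <= t <= b]) ->
  exists x : int -> R, [/\ forall i, P (x i), forall i, x i < x (i + 1),
    forall i t, x i < t < x (i + 1) -> ~ P t &
    forall t, exists i, x i <= t <= x (i + 1)].
Proof.
move=> [t0 Pt0] l0 per fin.
have pern t n : P (t + n%:R * l) <-> P t.
  elim: n => [|n IH]; first by rewrite mul0r addr0.
  by rewrite -natr1 mulrDl mul1r addrA -per.
have big a b : exists n : nat, a < b + n%:R * l.
  exists (Num.bound `|(a - b) / l|); rewrite -ltrBlDl -ltr_pdivrMr //.
  by apply: le_lt_trans (ler_norm _) _; exact: archi_boundP (normr_ge0 _).
have [|x [x0 xP xS xg xc]] := enum_right Pt0 fin.
  by move=> a; have [n hn] := big a t0; exists (t0 + n%:R * l) => //; rewrite pern.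
pose Q : set R := [set t | P (- t)].
have [|||y [y0 yP yS yg yc]] := @enum_right Q (- t0).
- by rewrite /Q /= opprK.
- move=> a b; apply: (@sub_finite_set _ _
    [set - t | t in [set t | P t /\ - b <= t <= - a]]); last first.
    exact/finite_image/fin.
  by move=> t [Qt h]; exists (- t); rewrite ?opprK //; split=> //; lra.
- move=> a; have [n hn] := big a (- t0).
  exists (- t0 + n%:R * l) => //; rewrite /Q /= opprD opprK.
  by apply/(pern _ n); rewrite subrK.
(* The index is shifted on the negative side because [y 0] stands for [- t0], and [t0] is already
   [x 0]. *)
pose z (i : int) := match i with Posz n => x n | Negz n => - y n.+1 end.
have zN n : z (Negz n + 1) = - y n.
  case: n => [|n]; first by rewrite /= y0 opprK -x0.
  by have -> : (Negz n.+1 + 1 = Negz n) by lia.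
have zS n : z (Posz n + 1) = x n.+1 by rewrite -PoszD addn1.
exists z; split.
- by case=> n; [exact: xP|have := yP n.+1].
- by case=> n; [rewrite zS; exact: xS|rewrite zN /= ltrN2; exact: yS].
- case=> n t; first by rewrite zS; exact: xg.
  rewrite zN /= => h Pt; apply: (yg n (- t)); first by lra.
  by rewrite /Q /= opprK.
- move=> t; have [h|h] := leP t0 t.
    have [n hn] := xc t h; exists (Posz n); rewrite zS /=; lra.
  have [|n hn] := yc (- t); first by lra.
  by exists (Negz n); rewrite zN /=; lra.
Qed.

End Enumeration.

(** * Dynamics on the axis *)

Section AxisProjection.
Variables (R : realType) (G : groupType) (T : gtree R G).
Variables (g : G) (l : R) (c : R -> T).
Hypothesis ax : is_axis g l c.
Implicit Types (x y z u v w p q : T) (r t : R).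
Let rt := gt_rtree T.
Let hc : isoline c. Proof. by case: ax. Qed.
Let l0 : 0 < l. Proof. by case: ax. Qed.

Definition projects_to x t := forall r, d x (c r) = d x (c t) + `|r - t|.

Lemma projects_zpow (h : G) x t (m : int) : is_axis h l c -> projects_to x t ->
  projects_to (act (zpow h m) x) (t + m%:~R * l).
Proof.
move=> axh px r.
have e r' : d (act (zpow h m) x) (c r') = d x (c (r' - m%:~R * l)).
  by rewrite -(gt_act_isometry (zpow h m) x) (axis_zpow _ _ axh) subrK.
by rewrite !e px addrK; congr (_ + `| _ |); lra.
Qed.

Lemma projects_seg p q tp tq r : projects_to p tp -> projects_to q tq ->
  tp < tq -> tp <= r <= tq -> segment p q (c r).
Proof.
move=> hp hq lt hr.
have n1 : `|tq - tp| = tq - tp by rewrite ger0_norm; lra.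
have n2 : `|tp - tq| = tq - tp by rewrite distrC.
have n3 : `|r - tp| = r - tp by rewrite ger0_norm; lra.
have n4 : `|r - tq| = tq - r by rewrite distrC ger0_norm; lra.
have sp : segment p (c tq) (c tp) by rewrite segE (hp tq) hc n1 n2.
have sq : segment (c tp) q (c tq).
  by apply: seg_sym; rewrite segE (hq tp) hc n1 n2.
have ne : c tp <> c tq by move/(isoline_inj hc); lra.
rewrite segE (seg_chain rt sp sq ne) (hp r) hc n2 n3 !(metric_sym _ q) (hq r) n4.
lra.
Qed.

Lemma big_multiple t : exists n : nat, t < n%:R * l.
Proof.
exists (Num.bound `|t / l|); rewrite -ltr_pdivrMr //.
by apply: le_lt_trans (ler_norm _) _; exact: archi_boundP (normr_ge0 _).
Qed.

(** If a vertex [v] projects inside an edge, a long segment between translates of [v] runs along the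
    axis there and contains that edge, whose end [a] is then on the axis. *)
Lemma axis_vtx : exists t, vtx (c t).
Proof.
have [v vv] := vtx_ex T; have [t ht] := isoline_proj rt v hc.
have [vt|nt] := pselect (vtx (c t)); first by exists t.
have [a [b [e hab]]] := nonvtx_edge nt.
(* Translating by more than the distance to [a] ensures that [a] lies on the part of [[p, q]] that
   follows the axis. *)
have [n hn] := big_multiple (d (c t) a).
have n0 : 0 < n%:R * l by apply: le_lt_trans hn; exact: mdist_ge0.
have hp := projects_zpow (- n%:Z) ax ht; have hq := projects_zpow n%:Z ax ht.
rewrite intrN mulNr -pmulrn in hp; rewrite -pmulrn in hq.
set p := act _ v in hp; set q := act (zpow g n) v in hq.
have mid r : t - n%:R * l <= r <= t + n%:R * l -> segment p q (c r).
  by move=> hr; apply: projects_seg hp hq _ hr; lra.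
have [|||sa _] := edge_sub_seg (p := p) (q := q) e _ _ nt hab (mid t _).
- by rewrite act_vtx.
- by rewrite act_vtx.
- by lra.
have [va _] := edge_vtx e.
pose r := t + (d p a - d p (c t)).
have bd : `|d p a - d p (c t)| < n%:R * l.
  by rewrite distrC -(seg_distn rt sa (mid t _)) 1?metric_sym //; lra.
have hr : t - n%:R * l < r < t + n%:R * l.
  by rewrite /r; move: bd; rewrite ltr_norml; lra.
exists r; have -> : c r = a; last by [].
have hr' : t - n%:R * l <= r <= t + n%:R * l by lra.
apply: (seg_uniq rt (mid r hr') sa).
rewrite (hp r) ger0_norm; last by lra.
have := hp t; rewrite ger0_norm; last by lra.
by rewrite /r; lra.
Qed.

End AxisProjection.

Section AxisDynamics.
Variables (R : realType) (G : groupType) (T : gtree R G).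
Variables (g : G) (l : R) (c : R -> T) (F : T -> T) (psi : G -> G) (k : R).
Implicit Types (x y z u v w p q : T) (r t : R).
Let rt := gt_rtree T.
Hypotheses (hT : in_D T) (fg : finitely_generated G).
Hypothesis FV : forall v, vtx v -> vtx (F v).
Hypothesis k1 : 1 < k.
Hypothesis Fdil : forall n u v, edge u v -> dilates (iter n F) (k ^+ n) u v.
Hypothesis Fpsi : forall h x, F (act h x) = act (psi h) (F x).
Hypothesis psiM : forall h1 h2 : G, psi (h1 * h2)%g = (psi h1 * psi h2)%g.
(** In the application each [psi^n g] is [g] times an element fixing the axis pointwise. *)
Hypothesis axpsi : forall n, is_axis (iter n psi g) l c.
Let ax : is_axis g l c := axpsi 0.
Let hc : isoline c. Proof. by case: ax. Qed.
Let l0 : 0 < l. Proof. by case: ax. Qed.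

Lemma iter_equivariant n h x : iter n F (act h x) = act (iter n psi h) (iter n F x).
Proof. by elim: n => //= n ->; rewrite Fpsi. Qed.

Lemma iter_morph n (h1 h2 : G) :
  iter n psi (h1 * h2)%g = (iter n psi h1 * iter n psi h2)%g.
Proof. by elim: n => //= n ->; rewrite psiM. Qed.

Lemma iter_axis_shift n t (m : int) :
  iter n F (c (t + m%:~R * l)) = act (zpow (iter n psi g) m) (iter n F (c t)).
Proof.
rewrite -(axis_zpow _ _ ax) iter_equivariant.
by rewrite (zpow_morph_eq (f := iter n psi)) //; exact: iter_morph.
Qed.

Lemma iter_line_shift n t r (m : int) : iter n F (c t) = c r ->
  iter n F (c (t + m%:~R * l)) = c (r + m%:~R * l).
Proof. by move=> e; rewrite iter_axis_shift e (axis_zpow _ _ (axpsi n)). Qed.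

(** The ends of a long piece of the axis have images that project far apart, so the image path runs
    over the given edge; one edge of the piece covers its midpoint, hence all of it. *)
Lemma axis_edge_covered (a b : R) : edge (c a) (c b) -> exists a' b',
  edge (c a') (c b') /\
  forall z, segment (c a) (c b) z -> exists2 w, segment (c a') (c b') w & F w = z.
Proof.
move=> e; have [m hm nm] := edge_midpoint e.
have [va vb] := edge_vtx e.
have [r er] : exists r, m = c r.
  have [ab|ba] := leP a b; first by have [r _ ->] := isoline_seg rt hc ab hm; exists r.
  by have [r _ ->] := isoline_seg rt hc (ltW ba) (seg_sym hm); exists r.
have [t vt] := axis_vtx ax.
have [s hs] := isoline_proj rt (F (c t)) hc.
(* Large enough for the projections of the two image points to lie on either side of [r]. *)
have [n hn] := big_multiple ax (`|r - s|).
have n0 : 0 < n%:R * l by apply: le_lt_trans hn; exact: normr_ge0.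
have hp := projects_zpow (- n%:Z) (axpsi 1) hs.
have hq := projects_zpow n%:Z (axpsi 1) hs.
rewrite -(iter_axis_shift 1) in hp; rewrite -(iter_axis_shift 1) in hq.
rewrite intrN mulNr -pmulrn /= in hp; rewrite -pmulrn /= in hq.
have vp : vtx (c (t - n%:R * l)).
  have := axis_zpow (- n%:Z) t ax; rewrite intrN mulNr -pmulrn => <-.
  by rewrite act_vtx.
have vq : vtx (c (t + n%:R * l)).
  by have := axis_zpow n%:Z t ax; rewrite -pmulrn => <-; rewrite act_vtx.
have mid : segment (F (c (t - n%:R * l))) (F (c (t + n%:R * l))) m.
  rewrite er; apply: projects_seg ax _ _ _ _ _ hp hq _ _; first lra.
  by move: hn; rewrite ltr_norml; lra.
have ne : c (t - n%:R * l) <> c (t + n%:R * l) by move/(isoline_inj hc); lra.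
have [p [q [epq hp1 hq1 hm1]]] := seg_cover_map vp vq ne mid.
have le : t - n%:R * l <= t + n%:R * l by lra.
have [a' _ ea'] := isoline_seg rt hc le hp1.
have [b' _ eb'] := isoline_seg rt hc le hq1.
have [vp' vq'] := edge_vtx epq.
have [sa sb] := edge_sub_seg e (FV vp') (FV vq') nm hm hm1.
exists a', b'; rewrite -ea' -eb'; split=> // z hz.
have k0 : 0 < k ^+ 1 by rewrite expr1; exact: lt_trans ltr01 k1.
exact: (dilates_surj k0 (Fdil 1 epq) (seg_convex rt sa sb hz)).
Qed.

(** Choosing covering edges backwards gives a sequence in which two edges are translates of each
    other, as there are finitely many modulo [g]. *)
Lemma covering_edge : exists n (m : int) (a b : R),
  [/\ (0 < n)%N, edge (c a) (c b) &
    forall z, segment (c (a + m%:~R * l)) (c (b + m%:~R * l)) z ->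
      exists2 w, segment (c a) (c b) w & iter n F w = z].
Proof.
have [e0 he0] : exists e : R * R, edge (c e.1) (c e.2).
  have [t vt] := axis_vtx ax.
  have vt' : vtx (c (t + l)) by have [_ _ <-] := ax; rewrite act_vtx.
  have [|w ew hw] := vtx_step vt vt' _; first by move/(isoline_inj hc); have := l0; lra.
  have [|r _ er] := isoline_seg rt hc _ hw; first by have := l0; lra.
  by exists (t, r); rewrite /= -er.
have /choice[N hN] : forall e : R * R, exists e' : R * R, edge (c e.1) (c e.2) ->
    edge (c e'.1) (c e'.2) /\ forall z, segment (c e.1) (c e.2) z ->
      exists2 w, segment (c e'.1) (c e'.2) w & F w = z.
  move=> e; have [he|no] := pselect (edge (c e.1) (c e.2)); last by exists e.
  by have [a [b h]] := axis_edge_covered he; exists (a, b).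
pose e n := iter n N e0.
have he n : edge (c (e n).1) (c (e n).2) by elim: n => //= n /hN[].
have cov i n z : segment (c (e i).1) (c (e i).2) z ->
    exists2 w, segment (c (e (n + i)%N).1) (c (e (n + i)%N).2) w & iter n F w = z.
  elim: n z => [|n IH] z hz; first by exists z.
  have [w hw <-] := IH z hz; have [w' hw' <-] := (hN _ (he (n + i)%N)).2 w hw.
  by exists w'; rewrite ?iterSr.
pose fl n := Num.floor ((e n).1 / l).
(* The translate by a power of [g] whose first end has its parameter in a fundamental interval. *)
pose red n := (c ((e n).1 - (fl n)%:~R * l), c ((e n).2 - (fl n)%:~R * l)).
have shift (t : R) (m : int) : c (t - m%:~R * l) = act (zpow g (- m)) (c t).
  by rewrite (axis_zpow _ _ ax) intrN mulNr.
have edge_red n : edge (red n).1 (red n).2.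
  by rewrite /red /= !shift; apply: act_edge.
have floor_eq n : 0 <= (e n).1 - (fl n)%:~R * l <= l.
  have /andP[h1 h2] := floor_itv ((e n).1 / l).
  rewrite ler_pdivlMr // in h1; rewrite ltr_pdivrMr // intrD mulrDl mul1r in h2.
  by rewrite /fl; lra.
have [t0 vt0] := axis_vtx ax.
pose B := [set v : T | vtx v /\ d (c t0) v <= l + `|t0|].
have fin : finite_set (\bigcup_(v in B) [set (v, w) | w in [set w | edge v w]]).
  apply: bigcup_finite => [|v _]; first exact: (finite_ball hT fg vt0 _ vt0).
  by apply: finite_image; exact: (finite_link hT fg vt0).
have [n|i [j [ij [e1 e2]]]] := finite_pigeonhole (F := red) fin.
  exists (red n).1; last by exists (red n).2 => //; exact: edge_red.
  split; first by have [] := edge_vtx (edge_red n).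
  rewrite /red /= hc; have := floor_eq n; move: (_ - _) => r hr.
  have : `|t0 - r| <= `|t0| + `|r| by exact: ler_normB.
  by rewrite (ger0_norm (x := r)); lra.
have {}e1 := isoline_inj hc e1; have {}e2 := isoline_inj hc e2.
exists (j - i)%N, (fl i - fl j), (e j).1, (e j).2; split.
- by rewrite subn_gt0.
- exact: he.
move=> z; rewrite intrB mulrBl.
have -> : (e j).1 + ((fl i)%:~R * l - (fl j)%:~R * l) = (e i).1 by lra.
have -> : (e j).2 + ((fl i)%:~R * l - (fl j)%:~R * l) = (e i).2 by lra.
by move=> /(cov i (j - i)%N); rewrite subnK // ltnW.
Qed.

(** The restriction of [H] to the edge is affine with factor [K > 1] and covers a translate of the
    edge, so the point matching its own translate is found by solving a linear equation. *)
Lemma periodic_axis_point : exists n (m : int) t,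
  (0 < n)%N /\ iter n F (c t) = c (t + m%:~R * l).
Proof.
have [n [m [a [b [n0 e cov]]]]] := covering_edge.
pose L := d (c a) (c b); pose K := k ^+ n; pose H := iter n F.
have hd : dilates H K (c a) (c b) := Fdil n e.
have K1 : 1 < K by rewrite /K exprn_egt1 // -lt0n.
have L0 : 0 < L := edge_gt0 e.
have shift (t : R) : c (t + m%:~R * l) = act (zpow g m) (c t).
  by rewrite (axis_zpow _ _ ax).
pose z1 := c (a + m%:~R * l); pose z2 := c (b + m%:~R * l).
have in_img z : segment z1 z2 z -> segment (H (c a)) (H (c b)) z.
  by move=> /cov[w hw <-]; exact: dilates_seg hd hw.
have h1 := in_img z1 (segl _ _); have h2 := in_img z2 (segr _ _).
have dz : d z1 z2 = L by rewrite /z1 /z2 !shift gt_act_isometry.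
have dH : d (H (c a)) (H (c b)) = K * L by rewrite hd //; [exact: segl|exact: segr].
have b1 := seg_le h1; have b2 := seg_le h2; rewrite dH in b1 b2.
suff [x hx e1] : exists2 x, segment (c a) (c b) x &
    d (H (c a)) (act (zpow g m) x) = K * d (c a) x.
  have [t ex] : exists t, x = c t.
    have [ab|ba] := leP a b; first by have [t _ ->] := isoline_seg rt hc ab hx; exists t.
    by have [t _ ->] := isoline_seg rt hc (ltW ba) (seg_sym hx); exists t.
  exists n, m, t; split=> //; rewrite shift -ex.
  apply: (seg_uniq rt (dilates_seg hd hx)).
    by apply: in_img; rewrite /z1 /z2 !shift act_seg.
  by rewrite e1 hd //; exact: segl.
have [le|gt] := leP (d (H (c a)) z1) (d (H (c a)) z2).
  have D2 := seg_dist rt h1 h2 le; rewrite dz in D2.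
  (* The solution of [K r = d (H (c a)) z1 + r], when the translate is crossed in the same
     direction. *)
  have [|x hx dx] := rt.1 (c a) (c b) (d (H (c a)) z1 / (K - 1)).
    rewrite divr_ge0 ?subr_ge0 ?(ltW K1) ?mdist_ge0 //=.
    by rewrite ler_pdivrMr ?subr_gt0 // -/L mulrBr mulr1 (mulrC L); lra.
  exists x => //.
  have sx : segment z1 z2 (act (zpow g m) x) by rewrite /z1 /z2 !shift act_seg.
  have [_] := seg_trans (seg_ord rt h1 h2 le) sx.
  have e1 : d z1 (act (zpow g m) x) = d (c a) x by rewrite /z1 shift gt_act_isometry.
  rewrite segE e1 dx => <-; have Kn : K - 1 != 0 by rewrite subr_eq0 gt_eqF.
  by field.
have {}gt := ltW gt.
have D2 := seg_dist rt h2 h1 gt; rewrite metric_sym dz in D2.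
(* With the direction reversed the equation is [K r = d (H (c a)) z1 - r]. *)
have [|x hx dx] := rt.1 (c a) (c b) (d (H (c a)) z1 / (K + 1)).
  have K0 : 0 < K + 1 by lra.
  rewrite divr_ge0 ?(ltW K0) ?mdist_ge0 //=.
  by rewrite ler_pdivrMr // -/L mulrDr mulr1 (mulrC L); lra.
exists x => //.
have sx : segment z1 z2 (act (zpow g m) x) by rewrite /z1 /z2 !shift act_seg.
have [_] := seg_trans (seg_ord rt h2 h1 gt) (seg_sym sx).
rewrite segE => <-.
have e2 : d z2 (act (zpow g m) x) = L - d (c a) x.
  by rewrite /z2 shift gt_act_isometry metric_sym /L; move: hx; rewrite segE; lra.
rewrite e2 dx; have -> : d (H (c a)) z2 = d (H (c a)) z1 - L by lra.
have Kn : K + 1 != 0 by rewrite gt_eqF //; lra.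
by field.
Qed.

End AxisDynamics.

(** * Axis points of a given rotation number and Nielsen paths *)

Section Concatenation.
Variables (R : realType) (G : groupType) (T : gtree R G).
Variables (g : G) (l : R) (c : R -> T) (f F : T -> T) (phi psi : G -> G) (k : R).
Variables (e0 : G) (M : nat).
Implicit Types (x y z u v w p q : T) (r s t a b : R).
Let rt := gt_rtree T.
Hypothesis k1 : 1 < k.
Hypothesis Fdil : forall n u v, edge u v -> dilates (iter n F) (k ^+ n) u v.
Hypothesis Fpsi : forall h x, F (act h x) = act (psi h) (F x).
Hypothesis psiM : forall h1 h2 : G, psi (h1 * h2)%g = (psi h1 * psi h2)%g.
Hypothesis axpsi : forall n, is_axis (iter n psi g) l c.
Hypothesis fphi : represents f phi.
Hypothesis M0 : (0 < M)%N.
Hypothesis FE : forall x, F x = act e0 (iter M f x).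
Let ax : is_axis g l c := axpsi 0.
Let hc : isoline c. Proof. by case: ax. Qed.
Let l0 : 0 < l. Proof. by case: ax. Qed.

Lemma iter_represents n h x : iter n f (act h x) = act (iter n phi h) (iter n f x).
Proof. by elim: n => //= n ->; rewrite fphi. Qed.

Lemma iter_FE n : exists b : G, forall x, iter n F x = act b (iter (n * M) f x).
Proof.
elim: n => [|n [b hb]]; first by exists 1%g => x; rewrite gt_act1.
exists (e0 * iter M phi b)%g => x.
by rewrite /= hb FE iter_represents -gt_actM mulSn iterD.
Qed.

Lemma nielsen_power n (h : G) x y j : iter n f x = act h x -> iter n f y = act h y ->
  exists H : G, iter (n * j) f x = act H x /\ iter (n * j) f y = act H y.
Proof.
move=> hx hy; elim: j => [|j [H [Hx Hy]]].
  by exists 1%g; rewrite muln0 !gt_act1.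
exists (iter (n * j) phi h * H)%g.
by rewrite mulnS addnC !iterD hx hy !iter_represents Hx Hy !gt_actM.
Qed.

Variables (n : nat) (m : int).
Hypothesis n0 : (0 < n)%N.

(** The factor [i] scales period and shift together, so that points with the same rotation number
    but different periods belong to one set. *)
Definition axis_periodic t : Prop := exists i, (0 < i)%N /\
  iter (n * i) F (c t) = c (t + (m * i%:Z)%:~R * l).

Lemma axis_periodicM i j t : iter (n * i) F (c t) = c (t + (m * i%:Z)%:~R * l) ->
  iter (n * (i * j)) F (c t) = c (t + (m * (i * j)%N%:Z)%:~R * l).
Proof.
move=> h; elim: j => [|j IH]; first by rewrite !muln0 mulr0 mul0r addr0.
rewrite mulnS mulnDr iterD IH (iter_line_shift Fpsi psiM axpsi _ h) -addrA -mulrDl.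
by congr (c (_ + _ * l)); rewrite -intrD; congr (_%:~R); rewrite PoszD mulrDr.
Qed.

Lemma axis_periodic2 s t : axis_periodic s -> axis_periodic t -> exists i,
  [/\ (0 < i)%N, iter (n * i) F (c s) = c (s + (m * i%:Z)%:~R * l) &
      iter (n * i) F (c t) = c (t + (m * i%:Z)%:~R * l)].
Proof.
move=> [i [i0 hi]] [j [j0 hj]]; exists (i * j)%N; split.
- by rewrite muln_gt0 i0.
- exact: axis_periodicM.
- by rewrite [(i * j)%N]mulnC; exact: axis_periodicM.
Qed.

Lemma axis_periodic_shift t : axis_periodic t <-> axis_periodic (t + l).
Proof.
have sh (q : int) s : axis_periodic s -> axis_periodic (s + q%:~R * l).
  move=> [i [i0 hi]]; exists i; split=> //.
  by rewrite (iter_line_shift Fpsi psiM axpsi _ hi); congr c; lra.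
split=> [/(sh 1)|/(sh (- 1))]; rewrite ?intrN ?mulNr mul1r //.
by rewrite addrK.
Qed.

(** A common iterate shifts both points equally along the axis, which preserves their distance,
    whereas on an edge it multiplies distances by a factor greater than 1. *)
Lemma axis_periodic_edge u v s t : edge u v -> segment u v (c s) ->
  segment u v (c t) -> axis_periodic s -> axis_periodic t -> s = t.
Proof.
move=> e hs ht Ps Pt; have [i [i0 hi hj]] := axis_periodic2 Ps Pt.
have := Fdil (n * i) e hs ht; rewrite hi hj !hc opprD addrACA subrr addr0 => h.
have K1 : 1 < k ^+ (n * i) by rewrite exprn_egt1 // -lt0n muln_gt0 n0.
apply/eqP; rewrite -subr_eq0 -normr_eq0; apply/eqP.
have := normr_ge0 (s - t); move: h; set D := `|s - t|.
by move=> h D0; have : (k ^+ (n * i) - 1) * D = 0; [lra|move/eqP; rewrite mulf_eq0 subr_eq0 gt_eqF //= => /eqP].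
Qed.

Lemma axis_periodic_finite a b : finite_set [set t | axis_periodic t /\ a <= t <= b].
Proof.
have [s vs] := axis_vtx ax.
(* This makes [[a, b]] lie between two translates of the vertex [c s], and the segment joining them
   has finitely many edges. *)
have [N hN] := big_multiple ax (`|a - s| + `|b - s|).
have N0 : 0 < N%:R * l.
  by apply: le_lt_trans hN; rewrite addr_ge0.
have n1 := ler_norm (a - s); have n2 := ler_norm (b - s).
have n3 : - `|a - s| <= a - s by rewrite lerNnormlW.
have n4 := normr_ge0 (a - s); have n5 := normr_ge0 (b - s).
set p := c (s - N%:R * l); set q := c (s + N%:R * l).
have vp : vtx p.
  have := axis_zpow (- N%:Z) s ax; rewrite intrN mulNr -pmulrn /p => <-.
  by rewrite act_vtx.
have vq : vtx q.
  by have := axis_zpow N%:Z s ax; rewrite -pmulrn /q => <-; rewrite act_vtx.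
have pq : p <> q by move/(isoline_inj hc); lra.
have [_ _ _ _ /(_ p q vp vq) fin] := gt_tree T.
apply: (@sub_finite_set _ _ (\bigcup_(P in (segment p q `&` vtx) `*` (segment p q `&` vtx))
  [set t | axis_periodic t /\ edge P.1 P.2 /\ segment P.1 P.2 (c t)])).
  move=> t [Pt ht].
  have hs : segment p q (c t) by apply: isoline_mem => //; lra.
  have [u [v [e hu hv huv]]] := seg_cover vp vq hs pq.
  by have [vu vv] := edge_vtx e; exists (u, v).
apply: bigcup_finite; first exact: finite_setX.
move=> [u v] _ /=.
have [[t [Pt [e ht]]]|no] := pselect (exists t, axis_periodic t /\ edge u v /\ segment u v (c t)).
  apply: (@sub_finite_set _ _ [set t]) => // t' [Pt' [_ ht']].
  exact: (axis_periodic_edge e ht' ht Pt' Pt).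
by apply: (@sub_finite_set _ _ set0) => // t ht; case: no; exists t.
Qed.

Lemma axis_periodic_nielsen s t : s <> t -> axis_periodic s -> axis_periodic t ->
  periodic_Nielsen f (c s) (c t).
Proof.
move=> st Ps Pt; have [i [i0 hi hj]] := axis_periodic2 Ps Pt.
split; first by move/(isoline_inj hc).
have [b hb] := iter_FE (n * i).
exists (n * i * M)%N, (b^-1 * zpow g (m * i%:Z))%g; split.
- by rewrite !muln_gt0 n0 i0 M0.
- by rewrite gt_actM (axis_zpow _ _ ax) -hi hb actK.
- by rewrite gt_actM (axis_zpow _ _ ax) -hj hb actK.
Qed.

(* A suitable power of F, composed with an element of G, fixes c s and c t and
   moves the splitting point z to a point at the same distances from both. *)
Lemma axis_periodic_split s t z : axis_periodic s -> axis_periodic t -> s <= t ->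
  segment (c s) (c t) z -> periodic_Nielsen f (c s) z -> periodic_Nielsen f z (c t) ->
  exists r, [/\ z = c r, s < r < t & axis_periodic r].
Proof.
move=> Ps Pt st hz [sz [n1 [h1 [n10 h1s h1z]]]] [zt [n2 [h2 [n20 h2z h2t]]]].
have [r hr ez] := isoline_seg rt hc st hz; exists r; split=> //.
  apply/andP; split; rewrite lt_neqAle.
    by case/andP: hr => -> _; rewrite andbT; apply/eqP => e; apply: sz; rewrite ez e.
  by case/andP: hr => _ ->; rewrite andbT; apply/eqP => e; apply: zt; rewrite ez e.
have [i [i0 his hit]] := axis_periodic2 Ps Pt.
(* Including [n1] and [n2] in the period lets a single power of [f] serve both Nielsen paths and
   both ends. *)
have hs := axis_periodicM (n1 * n2) his; have ht := axis_periodicM (n1 * n2) hit.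
set I := (i * (n1 * n2))%N in hs ht.
exists I; split; first by rewrite !muln_gt0 i0 n10.
have [b hb] := iter_FE (n * I).
have [H [Hs Hz]] := nielsen_power (n2 * (n * i * M)) h1s h1z.
have [H' [Hz' Ht]] := nielsen_power (n1 * (n * i * M)) h2z h2t.
have E1 : (n1 * (n2 * (n * i * M)) = n * I * M)%N by rewrite /I; lia.
have E2 : (n2 * (n1 * (n * i * M)) = n * I * M)%N by rewrite /I; lia.
rewrite E1 in Hs Hz; rewrite E2 in Hz' Ht.
pose u := (zpow g (- (m * I%:Z)) * b)%g.
have ushift w : act u (iter (n * I * M) f w) = act (zpow g (- (m * I%:Z))) (iter (n * I) F w).
  by rewrite hb -gt_actM.
have fixs : act u (act H (c s)) = c s.
  by rewrite -Hs ushift hs (axis_zpow _ _ ax) intrN mulNr addrK.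
have fixt : act u (act H' (c t)) = c t.
  by rewrite -Ht ushift ht (axis_zpow _ _ ax) intrN mulNr addrK.
have d1 : d (c s) (act u (iter (n * I * M) f z)) = d (c s) z.
  by rewrite Hz -{1}fixs !gt_act_isometry.
have d2 : d (act u (iter (n * I * M) f z)) (c t) = d z (c t).
  by rewrite Hz' -{1}fixt !gt_act_isometry.
have zz : act u (iter (n * I * M) f z) = z.
  apply: (seg_uniq rt _ hz d1); rewrite segE d1 d2; exact: hz.
rewrite -(axis_zpow _ _ ax) -ez -{2}zz ushift -gt_actM -zpowD addrN zpow0.
by rewrite gt_act1.
Qed.

Lemma axis_concatenation t0 : axis_periodic t0 -> concatenation_of_pINPs f (axis T g).
Proof.
move=> P0; have P1 : [set t | axis_periodic t] !=set0 by exists t0.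
have [x [xP xS xg xc]] := enum_int P1 l0 axis_periodic_shift axis_periodic_finite.
have xle i j : i <= j -> x i <= x j.
  move=> ij; have -> : j = i + `|j - i|%N%:Z by lia.
  elim: `|j - i|%N => [|N IH]; first by rewrite addr0.
  by apply: le_trans IH _; apply: ltW; rewrite -addn1 PoszD addrA; exact: xS.
exists (fun i => c (x i)); split.
- move=> i; have ne : x i <> x (i + 1) by move=> e; have := xS i; rewrite -e ltxx.
  split; first exact: (axis_periodic_nielsen ne (xP i) (xP (i + 1))).
  move=> [z hz [h1 h2]].
  have [r [_ hr Pr]] := axis_periodic_split (xP i) (xP (i + 1)) (ltW (xS i)) hz h1 h2.
  exact: xg hr Pr.
- by move=> i j q ij jq; apply: isoline_mem => //; rewrite !xle.
- rewrite (axisE ax); apply/seteqP; split=> [_ [t _ <-]|z [i _ hz]].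
    by have [i hi] := xc t; exists i => //; apply: isoline_mem => //.
  by have [t _ ->] := isoline_seg rt hc (ltW (xS i)) hz; exists t.
Qed.

End Concatenation.

(** * Representatives of an outer automorphism and conclusion *)

Lemma outer_conj (G : groupType) (Phi : set (G -> G)) phi phi' :
  outer_automorphism Phi -> Phi phi -> Phi phi' ->
  automorphism phi /\ exists e : G, forall x, phi' x = (e * phi x * e^-1)%g.
Proof.
move=> [phi0 [[bij phiM] ->]] [a ha] [b hb]; split; last first.
  by exists (b * a^-1)%g => x; rewrite hb ha invgM invgK !mulgA !mulgVK.
split; last first.
  by move=> x y; rewrite !ha phiM !mulgA mulgVK.
have -> : phi = (fun x => a * x * a^-1)%g \o phi0 by apply/funext => x; rewrite ha.
apply: bij_comp bij; exists (fun x => a^-1 * x * a)%g => x /=.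
  by rewrite !mulgA mulVg mul1g mulgVK.
by rewrite !mulgA mulgV mul1g mulgK.
Qed.

Lemma iter_conj (G : groupType) (phi phi' : G -> G) (e : G) n :
  automorphism phi -> (forall x, phi' x = (e * phi x * e^-1)%g) ->
  exists e' : G, forall x, iter n phi' x = (e' * iter n phi x * e'^-1)%g.
Proof.
move=> aphi h; have [_ phiM] := aphi.
elim: n => [|n [e' he']]; first by exists 1%g => x; rewrite invg1 mulg1 mul1g.
exists (e * phi e')%g => x.
by rewrite /= he' h !phiM (automorphism_inv _ aphi) invgM !mulgA.
Qed.

Theorem proposition4 (R : realType) (G : groupType) (hGBS : GBS G)
    (hns : non_solvable G) (Phi : set (G -> G))
    (hPhi : outer_automorphism Phi) (g : G) (hg : pseudo_periodic R Phi g)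
    (T : gtree R G) (hT : in_D T) (f : T -> T)
    (hf : train_track_representative Phi f) :
  concatenation_of_pINPs f (axis T g).
Proof.
have fg := GBS_finitely_generated hGBS.
have [[T0 hT0 lox] [phi1 [Phi1 [T1 hT1 [B bd]]]]] := hg.
have [[fV [lam lam1 str] _ leg] [phi Phi2 rep]] := hf.
(* Loxodromy is known in [T0] and passes to [T] through commensuration. *)
have nofix (x : T) : act g x <> x.
  move=> gx; have cg := elliptic_commensurating hT gx.
  by have [y hy] := commensurating_elliptic hns hT0 cg; exact: lox hy.
have [l [c ax]] := is_axis_ex nofix.
have [aphi [e he]] := outer_conj hPhi Phi2 Phi1.
have [aphi1 _] := outer_conj hPhi Phi1 Phi1.
have [M [u [s [M0 cs gs eM]]]] := bounded_orbit_pseudo_conj hT1 fg aphi1 bd.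
have [e' he'] := iter_conj M aphi he.
(* The relation was found for [phi1]; it passes to the automorphism [phi] represented by [f] because
   iterates of the two differ by an inner automorphism. *)
have [v ev] : exists v, iter M phi g = (v * (g * s) * v^-1)%g.
  exists (e'^-1 * u)%g; have := he' g; rewrite eM => h.
  have -> : iter M phi g = (e'^-1 * (u * (g * s) * u^-1) * e')%g.
    by rewrite h !mulgA mulVg mul1g mulgVK.
  by rewrite invgM invgK !mulgA.
(* Normalizing by [v] gives a map [F] that is equivariant for [psi], with [psi g = g s]. *)
pose psi h := (v^-1 * iter M phi h * v)%g.
pose F x := act v^-1%g (iter M f x).
have aM := automorphism_iter M aphi.
have apsi : automorphism psi.
  have [bij iM] := aM; split; last first.
    by move=> x y; rewrite /psi iM !mulgA mulgK.
  have -> : psi = (fun x => v^-1 * x * v)%g \o iter M phi by [].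
  apply: bij_comp bij; exists (fun x => v * x * v^-1)%g => x /=.
    by rewrite !mulgA mulgV mul1g mulgK.
  by rewrite !mulgA mulVg mul1g mulgVK.
have psig : psi g = (g * s)%g by rewrite /psi ev !mulgA mulVg mul1g mulgVK.
have psiM := apsi.2.
have Fpsi h x : F (act h x) = act (psi h) (F x).
  by rewrite /F (iter_represents rep) /psi !gt_actM actVK.
have FV w : vtx w -> vtx (F w).
  move=> vw; rewrite /F act_vtx.
  by elim: (M) => //= n; exact: fV.
have lamM : 1 < lam ^+ M by rewrite exprn_egt1 // -lt0n.
have FE x : F x = act v^-1%g (iter M f x) by [].
have Fdil n w z : edge w z -> dilates (iter n F) ((lam ^+ M) ^+ n) w z.
  move=> ewz x y hx hy; have [b hb] := iter_FE rep FE n.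
  rewrite !hb gt_act_isometry -exprM mulnC.
  exact: (edge_dilates lam1 fV str leg (M * n) ewz hx hy).
(* Commensuration and commutation are preserved by [psi], so each [psi^n s] is elliptic and fixes
   the axis pointwise; multiplying [psi^n g] by it leaves the action on the axis unchanged. *)
have inv n : is_axis (T := T) (iter n psi g) l c /\
    (commensurating (iter n psi s) /\
     (iter n psi s * iter n psi g = iter n psi g * iter n psi s)%g).
  elim: n => [|n [axn [cn en]]]; first by [].
  split; last first.
    split; last by rewrite /= -!psiM en.
    by apply/(automorphism_commensurating _ apsi).
  have [y hy] := commensurating_elliptic hns hT cn.
  have fixed := axis_fixed axn en hy; have [l0 hc hn] := axn.
  split=> // t.
  by rewrite iterSr psig (iter_morph psiM) gt_actM fixed hn.
have axpsi n := (inv n).1.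
have [n [m [t [n0 ht]]]] :=
  periodic_axis_point hT fg FV lamM Fdil Fpsi psiM axpsi.
apply: (axis_concatenation lamM Fdil Fpsi psiM axpsi rep M0 FE n0 (m := m) (t0 := t)).
by exists 1%N; rewrite muln1 mulr1.
Qed.
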